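(* For any finite digraph $G$ and any $n\ge 1$, the following is true. (a) $\operatorname{spec}G^n$ is determined by $\operatorname{spec}^{(a)}G$. (b) $\operatorname{spec}G^n$ is determined by $\operatorname{spec}G$. (c) If $\Omega_r(G)=\{0\}$ for some $r\ge 2$, then $\operatorname{spec}G^n$ is determined by the Euler characteristic $\chi(G)$ and the sequence $\{\operatorname{spec}\Delta_q(G)\}_{q=0}^{r-2}$.
   Context: A digraph $G=(V,E)$ consists of a finite vertex set $V$ and a set $E$ of ordered pairs of distinct vertices (arrows), written $i\to j$. An elementary $p$-path ($p\ge 0$) is a sequence $i_0\dots i_p$ of vertices, with associated basis symbol $e_{i_0\dots i_p}$; it is regular if $i_{k-1}\ne i_k$ for all $k$, and allowed if $i_{k-1}\to i_k$ for all $k$. $\mathcal R_p$ is the real vector space with basis the regular elementary $p$-paths. The boundary operator $\partial:\mathcal R_p\to\mathcal R_{p-1}$ is $\partial e_{i_0\dots i_p}=\sum_{k=0}^p(-1)^k e_{i_0\dots\widehat{i_k}\dots i_p}$, where every non-regular term on the right is replaced by $0$; and $\mathcal R_{-1}=\{0\}$, $\partial e_i=0$. $\mathcal A_p\subset\mathcal R_p$ is the span of the allowed elementary $p$-paths ($\mathcal A_{-1}=\{0\}$), and $\Omega_p=\Omega_p(G)=\{u\in\mathcal A_p:\partial u\in\mathcal A_{p-1}\}$. Then $\partial\Omega_p\subset\Omega_{p-1}$ and $\partial^2=0$. Given inner products on the spaces $\Omega_p$, the Hodge Laplacian on $\Omega_p$ is $\partial\partial^*+\partial^*\partial$, where $\partial^*:\Omega_{p-1}\to\Omega_p$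 is the adjoint of $\partial:\Omega_p\to\Omega_{p-1}$. The canonical Hodge Laplacian $\Delta_p(G)$ corresponds to the inner product $\langle\cdot,\cdot\rangle$ (restricted from $\mathcal R_p$) for which the regular elementary paths are orthonormal. The normalized Hodge Laplacian $\Delta_p^{(a)}(G)$ corresponds to the inner product $\frac{1}{p!}\langle\cdot,\cdot\rangle$ on $\mathcal R_p$ (weight $a_p=p!$). $\operatorname{spec}A$ is the multiset of eigenvalues of the self-adjoint operator $A$, counted with multiplicity. The Hodge spectrum of $G$ is the sequence $\operatorname{spec}G=\{\operatorname{spec}\Delta_p(G)\}_{p=0}^\infty$, and the normalized Hodge spectrum is $\operatorname{spec}^{(a)}G=\{\operatorname{spec}\Delta_p^{(a)}(G)\}_{p=0}^\infty$. The Cartesian product $X\Box Y$ of digraphs has vertex set $X\times Y$, with $(x_1,y_1)\to(x_2,y_2)$ iff either $x_1=x_2$ and $y_1\to y_2$, or $x_1\to x_2$ and $y_1=y_2$. $G^n=G\Box\cdots\Box G$ ($n$ factors). If $\Omega_p(G)=\{0\}$ for all large enough $p$, the Euler characteristic is $\chi(G)=\sum_{p\ge0}(-1)^p\dim\Omega_p(G)$. It is known that $\Omega_r(G)=\{0\}$ implies $\Omega_p(G)=\{0\}$ for all $p>r$, so $\chi(G)$ is defined in (c). ''Quantity $Q(G)$ is determined by data $D(G)$'' means: for any two finite digraphs $G,G'$ (in (c), both satisfying $\Omega_r(G)=\Omega_r(G')=\{0\}$ for the given $r$) with $D(G)=D(G')$ one has $Q(G)=Q(G')$. *)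

(* Defs.v *)
From HB Require Import structures.
From mathcomp Require Import all_boot all_order all_algebra.
From mathcomp Require Import boolp classical_sets fsbigop reals.
From mathcomp Require Import zify ring lra.
Set Implicit Arguments.
Unset Strict Implicit.
Unset Printing Implicit Defensive.
Import Order.TTheory GRing.Theory Num.Theory.
Local Open Scope ring_scope.

Record digraph := Digraph {
  vertex :> finType;
  arrow : rel vertex;
  arrow_irr : irreflexive arrow }.
Arguments arrow {d} _ _.

Section CartesianProduct.
Variables X Y : digraph.

Definition cart_arrow : rel (X * Y)%type := fun u v =>
  ((u.1 == v.1) && arrow u.2 v.2) || (arrow u.1 v.1 && (u.2 == v.2)).

Lemma cart_arrow_irr : irreflexive cart_arrow.
Proof. by move=> u; rewrite /cart_arrow !arrow_irr andbF. Qed.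

Definition cart : digraph := Digraph cart_arrow_irr.
End CartesianProduct.

Lemma point_irr : irreflexive (fun _ _ : unit => false).
Proof. by []. Qed.

Definition point : digraph := Digraph point_irr.

(** [cart_pow G 1] is [G] itself and [cart_pow G n.+2] is
    [cart G (cart_pow G n.+1)]; [point] is only the value at [n = 0]. *)
Definition cart_pow (G : digraph) (n : nat) : digraph := iterop n cart G point.

Section Chains.
Variables (R : realType) (G : digraph).

Definition regular (s : seq G) : bool := sorted (fun x y => x != y) s.
Definition allowed (s : seq G) : bool := sorted arrow s.

Definition rpath (p : nat) := {t : p.+1.-tuple G | regular t}.

Definition rpath_seq p (t : rpath p) : seq G := tval (val t).
Coercion rpath_seq : rpath >-> seq.

Definition chain (p : nat) := {ffun rpath p -> R^o}.

(** [elem p s] is the basis vector e_s when [s] is a regular elementary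
    [p]-path, and [0] for any other sequence [s]. *)
Definition elem (p : nat) (s : seq G) : chain p :=
  [ffun t : rpath p => ((t : seq G) == s)%:R].

Definition del (k : nat) (s : seq G) : seq G := take k s ++ drop k.+1 s.

(** For [p = 0] the target is [chain 0.-1 = chain 0] instead of R_{-1} = 0; this
    is harmless because [elem 0 [::] = 0], so that the boundary vanishes on
    0-chains ([boundary0] below). *)
Definition boundary_fun (p : nat) (u : chain p) : chain p.-1 :=
  \sum_(t : rpath p) u t *: \sum_(k < p.+1) (-1) ^+ k *: elem p.-1 (del k t).

Lemma boundary_fun_linear p : linear (@boundary_fun p).
Proof.
move=> a u v; rewrite /boundary_fun scaler_sumr -big_split /=.
by apply: eq_bigr => t _; rewrite !ffunE scalerDl scalerA.
Qed.
HB.instance Definition _ p :=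
  GRing.isLinear.Build R (chain p) (chain p.-1) _ (@boundary_fun p)
    (@boundary_fun_linear p).

Definition boundary (p : nat) : 'Hom(chain p, chain p.-1) :=
  linfun (@boundary_fun p).

Definition allowed_space (p : nat) : {vspace chain p} :=
  <<[seq elem p (rpath_seq t) | t <- enum [pred t : rpath p | allowed t]]>>%VS.

(** For [p = 0] this is the whole of [allowed_space 0], as [boundary 0 = 0]. *)
Definition Omega (p : nat) : {vspace chain p} :=
  (allowed_space p :&: boundary p @^-1: allowed_space p.-1)%VS.

Lemma elem_eq0 p s : ~~ ((size s == p.+1) && regular s) -> elem p s = 0.
Proof.
move=> Ns; apply/ffunP => t; rewrite !ffunE; case: eqP => // ts.
by case/negP: Ns; rewrite -ts size_tuple eqxx (valP t).
Qed.

Lemma boundary_elem p (t : rpath p) :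
  boundary p (elem p t) = \sum_(k < p.+1) (-1) ^+ k *: elem p.-1 (del k t).
Proof.
rewrite lfunE /= /boundary_fun (bigD1 t) //= [X in _ + X]big1 ?addr0 => [|s /negPf st].
  by rewrite ffunE eqxx scale1r.
by rewrite ffunE /rpath_seq !val_eqE st scale0r.
Qed.

Lemma boundary0 : boundary 0 = 0.
Proof.
apply/lfunP => u; rewrite !lfunE /= /boundary_fun big1 // => t _.
rewrite big_ord1 elem_eq0 ?scaler0 //= /del take0 cat0s.
by rewrite size_drop /rpath_seq size_tuple.
Qed.

Lemma size_del k (s : seq G) : (k < size s)%N -> size (del k s) = (size s).-1.
Proof.
by move=> ks; rewrite size_cat size_drop size_take ks; case: (size s) ks => // m;
   rewrite ltnS subSS => /subnKC.
Qed.

Lemma chain_elem p (u : chain p) : u = \sum_t u t *: elem p (rpath_seq t).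
Proof.
apply/ffunP => s; rewrite sum_ffunE (bigD1 s) //= big1 => [|t /negPf ts].
  by rewrite addr0 !ffunE eqxx; exact: esym (mulr1 _).
by rewrite !ffunE /rpath_seq !val_eqE eq_sym ts scaler0.
Qed.

Lemma nth_del x0 k (s : seq G) i : (k < size s)%N ->
  nth x0 (del k s) i = nth x0 s (bump k i).
Proof.
move=> ks; rewrite nth_cat size_take ks /bump.
case: ltnP => ik; first by rewrite nth_take.
by rewrite nth_drop addSn subnKC.
Qed.

(** The formula for the boundary also holds on non-regular sequences, where both
    sides vanish. *)
Lemma boundary_seq p s : size s = p.+1 ->
  boundary p (elem p s) = \sum_(k < p.+1) (-1) ^+ k *: elem p.-1 (del k s).
Proof.
move=> ss; have [rs|Nrs] := boolP (regular s).
  have rs' : regular (Tuple (introT eqP ss)) by [].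
  exact: (boundary_elem (Sub (Tuple (introT eqP ss)) rs' : rpath p)).
rewrite elem_eq0 ?negb_and ?Nrs ?orbT // linear0.
have [x0 _] : exists x : G, true by case: (s) ss => // x; exists x.
have [i ip /eqP sii] : exists2 i, (i < p)%N & nth x0 s i == nth x0 s i.+1.
  case: (pselect (exists2 i, (i < p)%N & nth x0 s i == nth x0 s i.+1)) => // H.
  case/negP: Nrs; apply/(sortedP x0) => i; rewrite ss ltnS => ip.
  by apply/negP => e; apply: H; exists i.
have ip1 : (i < p.+1)%N by apply: ltnW.
have ip2 : (i.+1 < p.+1)%N by [].
have ne : Ordinal ip2 != Ordinal ip1.
  by rewrite -val_eqE /= gtn_eqF.
rewrite (bigD1 (Ordinal ip1)) //= (bigD1 (Ordinal ip2)) //=.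
rewrite [X in _ + (_ + X)]big1 => [|k /andP[]].
  suff -> : del i s = del i.+1 s by rewrite addr0 /= exprS mulN1r scaleNr subrr.
  apply: (@eq_from_nth _ x0) => [|j _]; first by rewrite !size_del ?ss.
  rewrite !nth_del ?ss // /bump; case: (ltngtP i j) => // <-.
  by rewrite [RHS]sii.
rewrite -!val_eqE /= => ki ki1; rewrite elem_eq0 ?scaler0 // negb_and orbC.
have ks : (k < size s)%N by rewrite ss.
apply/orP; left; apply/negP => /(sortedP x0) /(_ (unbump k i)).
have p0 : (0 < p)%N by apply: leq_trans ip.
rewrite size_del // ss /= !nth_del //.
have -> : bump k (unbump k i) = i by rewrite unbumpK // inE eq_sym.
have -> : bump k (unbump k i).+1 = i.+1.
  by move: ki ki1; rewrite /bump /unbump; case: (ltngtP k i) => //=; lia.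
have := ltn_ord k; rewrite sii eqxx; move: ki ki1 {ne ip1 sii} ip;
rewrite /unbump; lia.
Qed.

Lemma del_del k l (s : seq G) : (k <= l)%N -> (l.+1 < size s)%N ->
  del l (del k s) = del k (del l.+1 s).
Proof.
move=> kl ls; have [x0 _] : exists x : G, true by case: (s) ls => // x; exists x.
have ks : (k < size s)%N by lia.
apply: (@eq_from_nth _ x0) => [|j _]; first by rewrite !size_del //; lia.
rewrite !nth_del ?size_del //; [|lia..].
by congr nth; rewrite /bump; lia.
Qed.

Lemma boundaryK p (u : chain p) : boundary p.-1 (boundary p u) = 0.
Proof.
case: p u => [|n] u; first by rewrite /= boundary0 !lfunE.
rewrite [u]chain_elem !linear_sum /= big1 // => t _.
rewrite !linearZ /= boundary_elem; apply/eqP; rewrite scaler_eq0; apply/orP; right.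
have: size (rpath_seq t) = n.+2 by rewrite /rpath_seq size_tuple.
move: (rpath_seq t) => {}t st.
pose F k l := (-1) ^+ (k + l) *: elem n.-1 (del l (del k t)).
have -> : boundary n (\sum_(k < n.+2) (-1) ^+ k *: elem n (del k t)) =
    \sum_(k < n.+2) (\sum_(l < n.+1 | (k <= l)%N) F k l +
                     \sum_(l < n.+1 | ~~ (k <= l)%N) F k l).
  rewrite linear_sum; apply: eq_bigr => k _; rewrite linearZ /=.
  rewrite -(bigID (fun l : 'I_n.+1 => (k <= l)%N) xpredT (fun l => F k l)) /=.
  rewrite boundary_seq ?size_del ?st // scaler_sumr.
  by apply: eq_bigr => l _; rewrite scalerA -exprD.
rewrite big_split /= big_ord_recr /= [X in _ + X + _]big1; last first.
  by move=> l; rewrite leqNgt ltn_ord.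
rewrite addr0 [X in _ + X]big_ord_recl /= [X in _ + (X + _)]big1 // add0r.
rewrite (exchange_big_dep xpredT) //= -big_split big1 //= => k _.
under [X in _ + X]eq_bigl => l do rewrite -ltnNge ltnS.
rewrite -big_split big1 //= => l lk; rewrite /F -del_del ?st //; last first.
  by rewrite /bump /=; have := ltn_ord k; lia.
by rewrite /bump /= add1n addSn exprS mulN1r scaleNr addnC subrr.
Qed.

Lemma boundary_Omega p (u : chain p) :
  u \in Omega p -> boundary p u \in Omega p.-1.
Proof.
rewrite !memv_cap -!memv_preim => /andP[_ ->].
by rewrite boundaryK mem0v.
Qed.

(** [vsproj] only changes the type here; see [dOmegaE]. *)
Definition dOmega (p : nat) : 'Hom(subvs_of (Omega p), subvs_of (Omega p.-1)) :=
  linfun (vsproj (Omega p.-1) \o boundary p \o vsval).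

Lemma dOmegaE p (u : subvs_of (Omega p)) :
  vsval (dOmega p u) = boundary p (vsval u).
Proof. by rewrite lfunE /= vsprojK // boundary_Omega // subvsP. Qed.

Definition inner (a : nat -> R) (p : nat) (u v : subvs_of (Omega p)) : R :=
  (a p)^-1 * \sum_(t : rpath p) vsval u t * vsval v t.

End Chains.

(** The operator adjoint to [f] for the inner products [iU] and [iV], that is
    the unique [g] with [iV (f u) v = iU u (g v)]; for its existence in the case
    used below, see [codOmegaE]. *)
Definition adjoint (R : realType) (U V : vectType R)
    (iU : U -> U -> R) (iV : V -> V -> R) (f : 'Hom(U, V)) : 'Hom(V, U) :=
  xget 0 [set g : 'Hom(V, U) | forall u v, iV (f u) v = iU u (g v)]%classic.

(** The multiset of eigenvalues of [A], as a multiplicity function. *)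
Definition spec (R : realType) (U : vectType R) (A : 'End(U)) (x : R) : nat :=
  \dim (passmx.leigenspace A x).

Section Hodge.
Variables (R : realType) (G : digraph) (a : nat -> R).

Definition codOmega (p : nat) :
    'Hom(subvs_of (Omega R G p.-1), subvs_of (Omega R G p)) :=
  adjoint (@inner R G a p) (@inner R G a p.-1) (dOmega R G p).

Definition hodge_laplacian (p : nat) : 'End(subvs_of (Omega R G p)) :=
  ((dOmega R G p.+1 \o codOmega p.+1) + (codOmega p \o dOmega R G p))%VF.

Variable a_gt0 : forall p, 0 < a p.

Lemma innerP p b (u v w : subvs_of (Omega R G p)) :
  inner a (b *: u + v) w = b * inner a u w + inner a v w.
Proof.
rewrite /inner mulrCA -mulrDr; congr (_ * _).
rewrite mulr_sumr -big_split /=.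
by apply: eq_bigr => t _; rewrite !ffunE mulrDl -mulrA.
Qed.

Lemma innerC p (u v : subvs_of (Omega R G p)) : inner a u v = inner a v u.
Proof. by congr (_ * _); apply: eq_bigr => t _; rewrite mulrC. Qed.

Lemma inner0 p (u : subvs_of (Omega R G p)) : inner a u 0 = 0.
Proof.
by rewrite /inner big1 ?mulr0 // => t _; rewrite linear0 ffunE mulr0.
Qed.

Lemma inner_eq0 p (u : subvs_of (Omega R G p)) : inner a u u = 0 -> u = 0.
Proof.
move=> /eqP; rewrite mulf_eq0 invr_eq0 gt_eqF //= psumr_eq0 => [/allP u0|t _].
  apply/val_inj/ffunP => t; rewrite ffunE; apply/eqP.
  by have := u0 t (mem_index_enum t); rewrite mulf_eq0 orbb.
exact: sqr_ge0.
Qed.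

Lemma codOmegaE p u v :
  inner a (dOmega R G p u) v = inner a u (codOmega p v).
Proof.
set U := subvs_of (Omega R G p); set V := subvs_of (Omega R G p.-1).
suff [g gP] : exists g : 'Hom(V, U), forall u v,
    inner a (dOmega R G p u) v = inner a u (g v).
  exact: (@xgetI _ 0 [set g : 'Hom(V, U) | forall u v,
    inner a (dOmega R G p u) v = inner a u (g v)]%classic _ gP).
pose b := vbasis (fullv : {vspace U}); pose m := \dim (fullv : {vspace U}).
pose F (w : U) : 'rV[R]_m := \row_i inner a w b`_i.
pose H (w : V) : 'rV[R]_m := \row_i inner a w (dOmega R G p b`_i).
have Flin : linear F by move=> c x y; apply/rowP => i; rewrite !mxE innerP.
have Hlin : linear H by move=> c x y; apply/rowP => i; rewrite !mxE innerP.
pose Fm := GRing.isLinear.Build R U 'rV[R]_m _ F Flin.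
pose Hm := GRing.isLinear.Build R V 'rV[R]_m _ H Hlin.
pose FL : {linear U -> 'rV[R]_m} := HB.pack F Fm.
pose HL : {linear V -> 'rV[R]_m} := HB.pack H Hm.
have extend (x y : U) : (forall i : 'I_m, inner a x b`_i = inner a y b`_i) ->
    forall z, inner a x z = inner a y z.
  move=> xy z; rewrite (coord_vbasis (memvf z)).
  elim/big_rec: _ => [|i s _ IH]; first by rewrite !inner0.
  by rewrite !(innerC _ (_ + _)) !innerP !(innerC b`_i) xy !(innerC s) IH.
have kF : lker (linfun FL) == 0%VS.
  apply/lker0P => x y; rewrite !lfunE /= => /rowP Fxy.
  apply/eqP; rewrite -subr_eq0; apply/eqP/inner_eq0.
  have E : forall z, inner a x z = inner a y z.
    by apply: extend => i; have := Fxy i; rewrite !mxE.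
  by rewrite addrC -scaleN1r innerP E mulN1r addNr.
have fF : limg (linfun FL) = fullv.
  apply/eqP; rewrite eqEdim subvf (limg_dim_eq) ?(eqP kF) ?capv0 //.
  by rewrite dimvf /dim /= mul1n.
exists ((linfun FL)^-1%VF \o linfun HL)%VF => x y.
have Fg (i : 'I_m) : inner a (((linfun FL)^-1 \o linfun HL)%VF y) b`_i =
    inner a y (dOmega R G p b`_i).
  have : linfun FL (((linfun FL)^-1 \o linfun HL)%VF y) = linfun HL y.
    by rewrite comp_lfunE limg_lfunVK // fF memvf.
  by rewrite !lfunE /= => /rowP /(_ i); rewrite !mxE lfunE.
rewrite (coord_vbasis (memvf x)).
elim/big_rec: _ => [|i s _ IH].
  by rewrite linear0 innerC inner0 innerC inner0.
by rewrite linearP !innerP IH innerC -Fg [in RHS]innerC innerC.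
Qed.

End Hodge.
Arguments hodge_laplacian : clear implicits.

Section Spectra.
Variables (R : realType) (G : digraph).

Definition hodge_spec (p : nat) : R -> nat :=
  spec (hodge_laplacian R G (fun=> 1) p).

Definition normalized_hodge_spec (p : nat) : R -> nat :=
  spec (hodge_laplacian R G (fun q => q`!%:R) p).

(** A finitely supported sum: it is the alternating sum of the dimensions when
    almost all [Omega R G p] are zero, and [0] by convention otherwise. *)
Definition euler_char : int :=
  \sum_(p \in [set: nat]%classic) (-1) ^+ p * (\dim (Omega R G p))%:Z.
End Spectra.
Arguments hodge_spec : clear implicits.
Arguments normalized_hodge_spec : clear implicits.

(* Main.v *)
Require Import Defs.
From HB Require Import structures.
From mathcomp Require Import all_boot all_order all_algebra.
From mathcomp Require Import boolp classical_sets fsbigop reals.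
From mathcomp Require Import zify ring lra.
From mathcomp Require Import complex.
Set Implicit Arguments.
Unset Strict Implicit.
Unset Printing Implicit Defensive.
Import Order.TTheory GRing.Theory Num.Theory.
Local Open Scope ring_scope.

(** The spectrum of a Cartesian power is computed from the spectrum of the
    factor, and the two families of spectra carry the same information.

    Products.  The normalization by p! makes the cross product isometric.  The
    cross product of a p-chain u and a q-chain v spreads u(s) v(t), with the
    shuffle sign, over all lattice paths projecting to s and t.  There are
    binomial(p+q, p) of them, so that with weights p! the inner product of two
    cross products is the product of the inner products ([inner_cross]).  The
    boundary satisfies the Leibniz rule ([bd_cross]), hence so does its adjoint
    ([codOmega_cross]), and the mixed terms cancel in the Laplacian, which acts
    on u x v as Delta u x v + u x Delta v ([laplacian_cross]).  The Kuenneth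
    isomorphism is used in the form: an element of Omega_r(X x Y) orthogonal to
    all cross products is zero ([omega_cross_orth]).  Thus the products of
    orthonormal eigenvectors of X and Y form an orthonormal eigenbasis of the
    product, and its eigenvalues are the sums lambda + mu ([spec_cross]); by
    induction the normalized spectrum of G determines that of G^n.

    Change of weights.  On Omega_p, the Laplacian with weights a is
    c_(p+1) L_p + c_p K_p, where c_p = a_p / a_(p-1), and L_p (boundary after
    coboundary) and K_p (coboundary after boundary) belong to unit weights.
    As L K = K L = 0, the nonzero eigenvalues of the two summands are simply
    put together; and L_p and K_(p+1) have the same nonzero eigenvalues
    ([spec_laplacian]).  So the spectra in degrees up to P determine, by
    induction on the degree, the nonzero spectra of K_0, ..., K_(P+1) and the
    dimensions of Omega_0, ..., Omega_P, and knowing these in all degrees gives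
    the spectra for any other weights.  This makes the canonical and the
    normalized spectra equivalent data.

    Truncation.  If Omega_r = 0, then Omega_p = 0 for all p >= r
    ([Omega_stable]).  The spectra in degrees up to r-2 give all the nonzero
    spectra of the K_p and all the dimensions but that of Omega_(r-1), which is
    then read off from the Euler characteristic.

    All computations with paths are done on functions of arbitrary vertex
    sequences.  Boundary and cross product become recursions on the sequence at
    which the result is evaluated, and no cast between degrees is needed. *)

(** * The boundary as a recursion on sequences *)

Section Boundary.
Variables (R : comNzRingType) (V : finType).
Implicit Types (f g : seq V -> R) (s t : seq V).

(** The coefficient at [s] of the boundary of [f]: the alternating sum, over all
    places of [s], of the values of [f] on the sequences obtained by inserting
    one vertex there.  It is the boundary operator only at regular [s]; at a
    non-regular [s] it may be nonzero although the boundary has no such term. *)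
Fixpoint bd f s : R :=
  \sum_(x : V) f (x :: s) -
  (if s is y :: s' then bd (fun t => f (y :: t)) s' else 0).

Lemma bd_cons f y s :
  bd f (y :: s) = \sum_x f (x :: y :: s) - bd (fun t => f (y :: t)) s.
Proof. by []. Qed.

Lemma eq_bd f g s : f =1 g -> bd f s = bd g s.
Proof. by move=> /funext ->. Qed.

Lemma bd0 f s : (forall t, f t = 0) -> bd f s = 0.
Proof.
elim: s f => [|y s IH] f f0 /=; rewrite big1 ?IH // ?subr0 //.
Qed.

Lemma bd_sum (I : Type) (r : seq I) (P : pred I) (F : I -> seq V -> R) s :
  bd (fun t => \sum_(i <- r | P i) F i t) s = \sum_(i <- r | P i) bd (F i) s.
Proof.
elim: s F => [|y s IH] F /=.
  by rewrite subr0 exchange_big; apply: eq_bigr => i _; rewrite subr0.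
by rewrite IH exchange_big -sumrB.
Qed.

Lemma bdZ a f s : bd (fun t => a * f t) s = a * bd f s.
Proof.
elim: s f => [|y s IH] f /=; first by rewrite !subr0 mulr_sumr.
by rewrite IH -mulr_sumr mulrBr.
Qed.

Lemma bd_sign f s :
  bd (fun t => (-1) ^+ (size t).+1 * f t) s = - ((-1) ^+ (size s).+1 * bd f s).
Proof.
elim: s f => [|y s IH] f /=.
  by rewrite -mulr_sumr !subr0 /=; ring.
rewrite -mulr_sumr.
under [X in _ - X]eq_bd => t do rewrite exprS -mulrA.
by rewrite bdZ IH !exprS; ring.
Qed.

(** If [f] vanishes on every sequence stepping directly from [u] to [v], then only
    the insertion of a vertex between [u] and [v] can contribute. *)
Lemma bd_gap f u v s1 s2 :
  (forall t1 t2, f (t1 ++ [:: u, v & t2]) = 0) ->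
  bd f (s1 ++ [:: u, v & s2]) =
  (-1) ^+ (size s1).+1 * \sum_x f (s1 ++ [:: u, x, v & s2]).
Proof.
elim: s1 f => [|y s1 IH] f f0.
  rewrite /= big1 => [|x _]; last exact: (f0 [:: x]).
  by rewrite [X in _ - (_ - X)]bd0 => [|t]; [rewrite expr1 mulN1r; ring|exact: (f0 [::])].
rewrite cat_cons bd_cons big1 => [|x _]; last by have /= -> := f0 [:: x, y & s1].
rewrite IH => [|t1 t2]; last exact: (f0 (y :: t1)).
by rewrite /= !exprS; ring.
Qed.

(** This matches the insertions above with the deletions by which the boundary of
    an elementary path is defined. *)
Lemma bd_delta t s : size t = (size s).+1 ->
  bd (fun t' => (t == t')%:R) s =
  \sum_(k < size t) (-1) ^+ k * (take k t ++ drop k.+1 t == s)%:R.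
Proof.
elim: s t => [|y s IH] [|x t] //= [].
  move/size0nil => ->; rewrite big_ord1 /= mul1r subr0.
  rewrite (bigD1 x) //= !eqxx big1 ?addr0 // => i /negPf xi.
  by rewrite eqseq_cons eq_sym xi.
move=> st; rewrite (bigD1 x) //= [X in _ + X - _]big1 => [|i /negPf xi].
  2: by rewrite eqseq_cons eq_sym xi.
rewrite big_ord_recl /= drop0 [x :: t == _]eqseq_cons eqxx mul1r addr0 /=;
  congr (_ + _).
under eq_bd => t' do rewrite eqseq_cons -mulnb natrM.
rewrite bdZ (IH _ st) mulr_sumr -sumrN; apply: eq_bigr => k _.
by rewrite eqseq_cons -mulnb natrM exprS /=; ring.
Qed.
End Boundary.

(** * The cross product and the Leibniz rule *)

Section Cross.
Variables (R : comNzRingType) (X Y : finType).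
Implicit Types (c d : seq X -> seq Y -> R) (z : seq (X * Y)).

(** [regular], for a bare type of vertices. *)
Definition stutter_free (T : eqType) (s : seq T) := sorted (fun x y => x != y) s.

(** The functions remaining after the lattice path has made its first step, in
    the first or in the second direction.  A step in the second direction passes
    over all later steps in the first one; for [s] of size [p + 1] there are [p]
    of these, and [(-1) ^+ (p + 2)] is the resulting sign. *)
Definition xslice (a : X) c : seq X -> seq Y -> R := fun s t => c (a :: s) t.
Definition yslice (b : Y) c : seq X -> seq Y -> R :=
  fun s t => (-1) ^+ (size s).+1 * c s (b :: t).

Definition xstep (u v : X * Y) := (u.1 != v.1) && (u.2 == v.2).
Definition ystep (u v : X * Y) := (u.1 == v.1) && (u.2 != v.2).

(** The sum over [s], [t] of [c s t] times the cross product of the elementary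
    paths [s] and [t], evaluated at [z].  Working with functions [c] of two
    sequences, and not only with products [f s * g t], is what lets the same
    recursion serve for the boundary ([bd_total]) and for the converse statement
    that functions on lattice paths come from such a [c] ([cross_unshuffle]). *)
Fixpoint cross c z : R :=
  if z is u :: z' then
    if z' is v :: _ then
      if xstep u v then cross (xslice u.1 c) z'
      else if ystep u v then cross (yslice u.2 c) z' else 0
    else c [:: u.1] [:: u.2]
  else 0.

Arguments cross : simpl never.

Lemma cross1 c u : cross c [:: u] = c [:: u.1] [:: u.2].
Proof. by []. Qed.

Lemma cross_cons c u v z : cross c [:: u, v & z] =
  if xstep u v then cross (xslice u.1 c) (v :: z)
  else if ystep u v then cross (yslice u.2 c) (v :: z) else 0.
Proof. by []. Qed.

Lemma eq_cross c d u z :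
  (forall s t, stutter_free (u.1 :: s) -> stutter_free (u.2 :: t) ->
     c (u.1 :: s) (u.2 :: t) = d (u.1 :: s) (u.2 :: t)) ->
  cross c (u :: z) = cross d (u :: z).
Proof.
elim: z u c d => [|v z IH] u c d cd; first exact: cd.
rewrite !cross_cons; case: ifP => [/andP[uv /eqP e]|_].
  by apply: IH => s t; rewrite /xslice -e => us vt; apply: cd => //=; rewrite uv.
case: ifP => [/andP[/eqP e uv]|//].
by apply: IH => s t; rewrite /yslice -e => us vt; rewrite cd //= uv.
Qed.

Lemma cross_lin a c d z :
  cross (fun s t => a * c s t + d s t) z = a * cross c z + cross d z.
Proof.
elim: z c d => [|u [|v z] IH] c d; [by rewrite /= mulr0 addr0|by []|].
rewrite !cross_cons; case: ifP => _; first exact: (IH (xslice _ _)).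
case: ifP => _; last by rewrite mulr0 addr0.
rewrite -IH; congr cross; apply/funext => s; apply/funext => t.
by rewrite /yslice; ring.
Qed.

Lemma cross0 z : cross (fun _ _ => 0) z = 0.
Proof.
elim: z => [|u [|v z] IH] //; rewrite cross_cons.
have -> : yslice u.2 (fun _ _ => 0) = fun _ _ => 0.
  by apply/funext => s; apply/funext => t; rewrite /yslice mulr0.
by rewrite IH !if_same.
Qed.

Lemma crossZ a c z : cross (fun s t => a * c s t) z = a * cross c z.
Proof.
rewrite -[RHS]addr0 -(cross0 z) -cross_lin.
by congr cross; apply/funext => s; apply/funext => t; rewrite addr0.
Qed.

Lemma cross_sum (I : Type) (r : seq I) (F : I -> seq X -> seq Y -> R) z :
  cross (fun s t => \sum_(i <- r) F i s t) z = \sum_(i <- r) cross (F i) z.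
Proof.
elim: r => [|i r IH].
  rewrite big_nil -[RHS](cross0 z); congr cross.
  by apply/funext => s; apply/funext => t; rewrite big_nil.
rewrite big_cons -IH -[cross (F i) z]mul1r -cross_lin.
congr cross; apply/funext => s; apply/funext => t.
by rewrite big_cons mul1r.
Qed.

Definition regular_supp c := forall s t, ~~ (stutter_free s && stutter_free t) -> c s t = 0.

Lemma regular_supp_xslice a c : regular_supp c -> regular_supp (xslice a c).
Proof.
move=> c0 s t st; apply: c0; apply: contra st => /andP[sa ->].
by rewrite andbT; case: s sa => //= x s /andP[].
Qed.

Lemma regular_supp_yslice b c : regular_supp c -> regular_supp (yslice b c).
Proof.
move=> c0 s t st; rewrite /yslice c0 ?mulr0 //; apply: contra st => /andP[-> sa].
by case: t sa => //= x t /andP[].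
Qed.

Lemma cross_xslice_id c v z : regular_supp c -> cross (xslice v.1 c) (v :: z) = 0.
Proof.
move=> c0; rewrite -(cross0 (v :: z)); apply: eq_cross => s t _ _.
by rewrite /xslice c0 //= eqxx.
Qed.

Lemma cross_yslice_id c v z : regular_supp c -> cross (yslice v.2 c) (v :: z) = 0.
Proof.
move=> c0; rewrite -(cross0 (v :: z)); apply: eq_cross => s t _ _.
by rewrite /yslice c0 ?mulr0 //= eqxx andbF.
Qed.

Lemma pair_sum (F : X * Y -> R) : \sum_u F u = \sum_a \sum_b F (a, b).
Proof. by rewrite pair_bigA; apply: eq_bigr => -[]. Qed.

(** A vertex joined to [u] by a lattice step lies in the row or the column of
    [u]. *)
Lemma sum_steps (F : X * Y -> R) (u : X * Y) :
  (forall w, ~~ xstep w u -> ~~ ystep w u -> F w = 0) ->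
  \sum_w F w = \sum_(a | a != u.1) F (a, u.2) + \sum_(b | b != u.2) F (u.1, b).
Proof.
case: u => a b F0 /=; rewrite pair_sum (bigD1 a) //= addrC; congr (_ + _).
  apply: eq_bigr => x xa; rewrite (bigD1 b) //= big1 ?addr0 // => y yb.
  by apply: F0; rewrite /xstep /ystep /= ?(negPf yb) ?(negPf xa) ?andbF.
by rewrite (bigD1 b) //= F0 ?add0r // /xstep /ystep /= !eqxx ?andbF.
Qed.

Lemma cross_front c v z : regular_supp c ->
  \sum_w cross c [:: w, v & z] =
  \sum_a cross (xslice a c) (v :: z) + \sum_b cross (yslice b c) (v :: z).
Proof.
move=> c0; rewrite (sum_steps (u := v)) => [|w /negPf xw /negPf yw]; last first.
  by rewrite cross_cons xw yw.
rewrite (bigD1 (P := xpredT) v.1) //= cross_xslice_id // add0r.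
rewrite [in RHS](bigD1 (P := xpredT) v.2) //= cross_yslice_id // add0r.
congr (_ + _).
  by apply: eq_bigr => a av; rewrite cross_cons /xstep /= av eqxx.
by apply: eq_bigr => b bv; rewrite cross_cons /xstep /ystep /= bv eqxx (negPf bv).
Qed.

Lemma cross_middle_x c u v z : regular_supp c -> xstep u v ->
  \sum_w cross c [:: u, w, v & z] = \sum_a cross (xslice a (xslice u.1 c)) (v :: z).
Proof.
move=> c0 /andP[uv1 /eqP uv2].
rewrite (sum_steps (u := v)) => [|w /negPf xw /negPf yw]; last first.
  by rewrite !cross_cons xw yw !if_same.
rewrite [X in _ + X]big1 => [|b bv]; last first.
  by rewrite cross_cons /xstep /ystep /= uv2 uv1 eq_sym (negPf bv) (negPf uv1).
rewrite addr0 [RHS](bigD1 v.1) //=.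
rewrite cross_xslice_id; last exact: regular_supp_xslice.
rewrite add0r; apply: eq_bigr => a av.
rewrite !cross_cons /xstep /ystep /= uv2 eqxx av /= andbT andbF; case: eqVneq => //= ->.
rewrite -(cross0 (v :: z)); apply: eq_cross => s t _ _.
by rewrite /xslice c0 //= eqxx.
Qed.

Lemma cross_middle_y c u v z : regular_supp c -> ystep u v ->
  \sum_w cross c [:: u, w, v & z] = \sum_b cross (yslice b (yslice u.2 c)) (v :: z).
Proof.
move=> c0 /andP[/eqP uv1 uv2].
rewrite (sum_steps (u := v)) => [|w /negPf xw /negPf yw]; last first.
  by rewrite !cross_cons xw yw !if_same.
rewrite [X in X + _]big1 => [|b bv]; last first.
  by rewrite cross_cons /xstep /ystep /= uv1 uv2 eq_sym (negPf bv) (negPf uv2).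
rewrite add0r [RHS](bigD1 v.2) //=.
rewrite cross_yslice_id; last exact: regular_supp_yslice.
rewrite add0r; apply: eq_bigr => a av.
rewrite !cross_cons /xstep /ystep /= uv1 eqxx /= av; case: (eqVneq u.2 a) => [<-|_] //=.
rewrite -(cross0 (v :: z)); apply: eq_cross => s t _ _.
by rewrite /yslice c0 ?mulr0 //= eqxx andbF.
Qed.

(** The two ways around a unit square carry opposite signs, so a diagonal step
    never appears in the boundary of a cross product. *)
Lemma cross_middle_diag c u v z : regular_supp c -> u.1 != v.1 -> u.2 != v.2 ->
  \sum_w cross c [:: u, w, v & z] = 0.
Proof.
move=> c0 uv1 uv2.
rewrite (sum_steps (u := v)) => [|w /negPf xw /negPf yw]; last first.
  by rewrite !cross_cons xw yw !if_same.
rewrite (bigD1 u.1) //= big1 ?addr0 => [|a /andP[av au]]; last first.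
  by rewrite cross_cons /xstep /ystep /= (negPf uv2) eq_sym (negPf au).
rewrite (bigD1 u.2) //= big1 ?addr0 => [|b /andP[bv bu]]; last first.
  by rewrite cross_cons /xstep /ystep /= (negPf uv1) eq_sym (negPf bu).
rewrite !cross_cons /xstep /ystep /= !eqxx uv1 uv2 (negPf uv1) (negPf uv2) /=.
rewrite -[X in X + _]mul1r -cross_lin -(cross0 (v :: z)).
by congr cross; apply/funext => s; apply/funext => t;
  rewrite /xslice /yslice !exprS /=; ring.
Qed.

(** The boundary of a tensor product of complexes, acting on functions of two
    sequences. *)
Definition bd_total c : seq X -> seq Y -> R := fun s t =>
  bd (fun s => c s t) s + (-1) ^+ (size s).+1 * bd (c s) t.

Lemma bd_total_xslice a c s t :
  bd_total c (a :: s) t = \sum_x c [:: x, a & s] t - bd_total (xslice a c) s t.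
Proof. by rewrite /bd_total /xslice /= !exprS; ring. Qed.

Lemma bd_total_yslice b c s t :
  yslice b (bd_total c) s t = \sum_y c s [:: y, b & t] - bd_total (yslice b c) s t.
Proof.
rewrite /bd_total /yslice /= bd_sign bdZ opprD opprK.
set e := (-1) ^+ _; have ee : e * e = 1 by rewrite /e -expr2 sqrr_sign.
by rewrite mulrDr !mulrA !ee !mul1r; ring.
Qed.

(** The Leibniz rule.  In the induction on [z], with first step from [u] to [v],
    the insertions between [u] and [v] are those insertions in front of [v], for
    the slice of [c] at [u], that go along the step; the ones that go across it
    occur for the slice only, and cancel against insertions in front of [u]. *)
Lemma bd_cross c u z : regular_supp c -> stutter_free (u :: z) ->
  bd (cross c) (u :: z) = cross (bd_total c) (u :: z).
Proof.
elim: z u c => [|v z IH] u c c0.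
  move=> _; rewrite /= cross_front // /bd_total /=.
  rewrite !subr0 cross1 /=; set A := (X in _ - X = _).
  have -> : A =
    \sum_a c [:: u.1; a] [:: u.2] + \sum_b c [:: u.1] [:: u.2; b].
    rewrite /A (sum_steps (u := u)) => [|w xw yw]; last first.
      rewrite cross_cons /xstep /ystep eq_sym (eq_sym u.2).
      by rewrite -/(xstep _ _) -/(ystep _ _) (negPf xw) (negPf yw).
    rewrite (bigD1 (P := xpredT) u.1) //= c0 /= ?eqxx // add0r.
    rewrite [in RHS](bigD1 (P := xpredT) u.2) //= (c0 _ [:: u.2; u.2]) /= ?eqxx // add0r.
    congr (_ + _); apply: eq_bigr => b bv.
      by rewrite cross_cons /xstep /= eq_sym bv eqxx.
    by rewrite cross_cons /xstep /ystep /= eqxx (eq_sym _ b) bv /= cross1 /yslice /= expr2 mulrNN !mul1r.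
  under [X in _ + X - _]eq_bigr => b _ do rewrite cross1 /yslice /= expr2 mulrNN !mul1r.
  by under [X in X + _ - _]eq_bigr => a _ do rewrite cross1 /xslice /=;
    rewrite expr2 mulrNN !mul1r; ring.
move=> /andP[uv vz].
rewrite bd_cons cross_front // bd_cons cross_cons.
under [X in _ - (_ - X)]eq_bd => t do rewrite cross_cons.
have [xuv|/negPf Nx] := boolP (xstep u v).
  rewrite cross_middle_x //.
  have := IH v _ (regular_supp_xslice u.1 c0) vz.
  rewrite bd_cons cross_front; last exact: regular_supp_xslice.
  move=> IHv.
  have -> : cross (xslice u.1 (bd_total c)) (v :: z) =
     \sum_x cross (xslice u.1 (xslice x c)) (v :: z) - cross (bd_total (xslice u.1 c)) (v :: z).
    rewrite -cross_sum -[X in _ - X]mul1r -mulNr addrC -cross_lin.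
    congr cross; apply/funext => s; apply/funext => t.
    by rewrite mulN1r addrC -bd_total_xslice.
  have E : \sum_b cross (yslice b c) [:: u, v & z] =
    - \sum_b cross (yslice b (xslice u.1 c)) (v :: z).
    rewrite -sumrN; apply: eq_bigr => b _; rewrite cross_cons xuv.
    rewrite -[RHS]mulN1r -crossZ; congr cross; apply/funext => s; apply/funext => t.
    by rewrite /xslice /yslice /= !exprS; ring.
  rewrite E; under eq_bigr => x _ do rewrite cross_cons xuv.
  rewrite -IHv; ring.
have [yuv|/negPf Ny] := boolP (ystep u v).
  rewrite cross_middle_y //.
  have := IH v _ (regular_supp_yslice u.2 c0) vz.
  rewrite bd_cons cross_front; last exact: regular_supp_yslice.
  move=> IHv.
  have -> : cross (yslice u.2 (bd_total c)) (v :: z) =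
     \sum_y cross (yslice u.2 (yslice y c)) (v :: z) - cross (bd_total (yslice u.2 c)) (v :: z).
    rewrite -cross_sum -[X in _ - X]mul1r -mulNr addrC -cross_lin.
    congr cross; apply/funext => s; apply/funext => t.
    rewrite mulN1r addrC bd_total_yslice; congr (_ - _); apply: eq_bigr => y _.
    by rewrite /yslice /= mulrA -expr2 sqrr_sign mul1r.
  have E : \sum_b cross (xslice b c) [:: u, v & z] =
    - \sum_b cross (xslice b (yslice u.2 c)) (v :: z).
    rewrite -sumrN; apply: eq_bigr => b _; rewrite cross_cons Nx yuv.
    rewrite -[RHS]mulN1r -crossZ; congr cross; apply/funext => s; apply/funext => t.
    by rewrite /xslice /yslice /= !exprS; ring.
  rewrite E; under [X in _ + X - _]eq_bigr => x _ do rewrite cross_cons Nx yuv.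
  rewrite -IHv; ring.
rewrite bd0 // subr0.
have [d1 d2] : u.1 != v.1 /\ u.2 != v.2.
  move: Nx Ny uv; case: u v {vz} => [a b] [a' b']; rewrite /xstep /ystep xpair_eqE /=.
  by case: (a == a'); case: (b == b').
rewrite cross_middle_diag // subr0 !big1 ?addr0 // => w _.
  by rewrite cross_cons Nx Ny.
by rewrite cross_cons Nx Ny.
Qed.
End Cross.
Arguments cross {R X Y} c z : simpl never.

(** * Inner products of cross products *)

Section SumSeq.
Variables (R : comNzRingType) (T : finType).

(** The sum of [h] over the sequences of length [n], in a form that peels off
    the first entry by computation. *)
Fixpoint seq_sum (n : nat) (h : seq T -> R) : R :=
  if n is m.+1 then \sum_x seq_sum m (fun s => h (x :: s)) else h [::].

Lemma eq_seq_sum n h h' : (forall s, size s = n -> h s = h' s) ->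
  seq_sum n h = seq_sum n h'.
Proof.
elim: n h h' => [|n IH] h h' hh; first exact: hh.
by apply: eq_bigr => x _; apply: IH => s sn; apply: hh; rewrite /= sn.
Qed.

Lemma seq_sum0 n h : (forall s, size s = n -> h s = 0) -> seq_sum n h = 0.
Proof.
move=> h0; rewrite (eq_seq_sum h0); elim: n {h0} => //= n IH.
by rewrite big1.
Qed.

Lemma seq_sum_sum (I : Type) (r : seq I) (P : pred I) (F : I -> seq T -> R) n :
  seq_sum n (fun t => \sum_(i <- r | P i) F i t) = \sum_(i <- r | P i) seq_sum n (F i).
Proof.
elim: n F => //= n IH F; rewrite exchange_big.
by apply: eq_bigr => x _; rewrite IH.
Qed.

Lemma seq_sumZ a n h : seq_sum n (fun t => a * h t) = a * seq_sum n h.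
Proof.
elim: n h => //= n IH h; rewrite mulr_sumr.
by apply: eq_bigr => x _; rewrite IH.
Qed.

Lemma seq_sum_tuple n h : seq_sum n h = \sum_(t : n.-tuple T) h t.
Proof.
elim: n h => [|n IH] h /=.
  rewrite (big_pred1 [tuple]) // => t; apply/esym/eqP; exact: tuple0.
rewrite (reindex (fun p : T * n.-tuple T => [tuple of p.1 :: p.2])) /=; last first.
  exists (fun t : n.+1.-tuple T => (thead t, [tuple of behead t])) => [[x t] _|t _] /=.
    by congr pair; apply: val_inj.
  by rewrite -tuple_eta.
by under eq_bigr do rewrite IH; rewrite pair_bigA.
Qed.
End SumSeq.

Section CrossSum.
Variables (R : comNzRingType) (X Y : finType).
Implicit Types (c d : seq X -> seq Y -> R).

(** Pascal's rule: a lattice path with [p] steps in the first direction out of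
    [r.+1] starts either with such a step or with one across.  The signs
    disappear as they occur squared. *)
Lemma seq_sum_cross_from r c d u : regular_supp c -> regular_supp d ->
  seq_sum r (fun z => cross c (u :: z) * cross d (u :: z)) =
  \sum_(p < r.+1) 'C(r, p)%:R * seq_sum p (fun s => seq_sum (r - p)
     (fun t => c (u.1 :: s) (u.2 :: t) * d (u.1 :: s) (u.2 :: t))).
Proof.
elim: r u c d => [|r IH] u c d c0 d0.
  by rewrite /= big_ord1 /= !cross1 bin0 mul1r.
pose N p q a b := seq_sum p (fun s => seq_sum q
     (fun t => c (a :: s) (b :: t) * d (a :: s) (b :: t))).
transitivity (\sum_(p < r.+1) 'C(r, p)%:R * N p.+1 (r - p)%N u.1 u.2 +
              \sum_(p < r.+1) 'C(r, p)%:R * N p (r - p).+1 u.1 u.2).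
  rewrite [LHS]/= (sum_steps (u := u)) => [|v xv yv]; last first.
    apply: seq_sum0 => z _; rewrite !cross_cons /xstep /ystep.
    rewrite eq_sym [u.2 == _]eq_sym -/(xstep v u) -/(ystep v u).
    by rewrite (negPf xv) (negPf yv) mul0r.
  congr (_ + _).
    transitivity (\sum_a seq_sum r (fun z => cross (xslice u.1 c) ((a, u.2) :: z) *
       cross (xslice u.1 d) ((a, u.2) :: z))).
      rewrite [RHS](bigD1 u.1) //= [X in _ = X + _]seq_sum0 ?add0r => [|z _].
        apply: eq_bigr => a au; apply: eq_seq_sum => z _.
        by rewrite !cross_cons /xstep /= eq_sym au eqxx.
      by rewrite (cross_xslice_id (u.1, u.2)) // mul0r.
    under eq_bigr do rewrite (IH _ _ _ (regular_supp_xslice _ c0) (regular_supp_xslice _ d0)).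
    rewrite exchange_big; apply: eq_bigr => p _ /=.
    by rewrite -mulr_sumr.
  transitivity (\sum_b seq_sum r (fun z => cross (yslice u.2 c) ((u.1, b) :: z) *
     cross (yslice u.2 d) ((u.1, b) :: z))).
    rewrite [RHS](bigD1 u.2) //= [X in _ = X + _]seq_sum0 ?add0r => [|z _].
      apply: eq_bigr => b bu; apply: eq_seq_sum => z _.
      by rewrite !cross_cons /xstep /ystep /= eqxx eq_sym bu.
    by rewrite (cross_yslice_id (u.1, u.2)) // mul0r.
  under eq_bigr do rewrite (IH _ _ _ (regular_supp_yslice _ c0) (regular_supp_yslice _ d0)).
  rewrite exchange_big; apply: eq_bigr => p _ /=.
  rewrite -mulr_sumr; congr (_ * _); rewrite /N -seq_sum_sum.
  apply: eq_seq_sum => s _ /=; apply: eq_bigr => b _; apply: eq_seq_sum => t _.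
  by rewrite /yslice mulrACA -expr2 sqrr_sign mul1r.
rewrite [RHS]big_ord_recl /= bin0 ?subn0 mul1r.
rewrite [X in _ + X = _]big_ord_recl /= bin0 ?subn0 mul1r.
rewrite [X in X + _ = _]big_ord_recr /= binn subnn mul1r.
rewrite [X in _ = _ + X]big_ord_recr /= binn subnn mul1r.
set A := \sum_(i < r) _; set B := \sum_(i < r) _; set C := \sum_(i < r) _.
transitivity (N 0%N r.+1 u.1 u.2 + (C + N r.+1 0%N u.1 u.2)); last by [].
suff -> : C = A + B by ring.
rewrite -big_split; apply: eq_bigr => i _ /=.
rewrite /bump /= !add1n binS natrD mulrDl addrC -/(N _ _ _ _) subSS.
by rewrite -subSn ?subSS.
Qed.

Lemma seq_sum_cross r c d : regular_supp c -> regular_supp d ->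
  seq_sum r.+1 (fun z => cross c z * cross d z) =
  \sum_(p < r.+1) 'C(r, p)%:R * seq_sum p.+1 (fun s => seq_sum (r - p).+1
     (fun t => c s t * d s t)).
Proof.
move=> c0 d0; rewrite /=.
under eq_bigr => u _ do rewrite seq_sum_cross_from //.
rewrite exchange_big; apply: eq_bigr => p _ /=.
rewrite -mulr_sumr pair_sum; congr (_ * _); apply: eq_bigr => a _ /=.
by rewrite -seq_sum_sum.
Qed.
End CrossSum.

(** * Recovering the factors from a function on lattice paths *)

Section Stair.
Variables (R : comNzRingType) (X Y : finType).
Implicit Types (c d : seq X -> seq Y -> R) (w : seq (X * Y) -> R).

(** The lattice path making first all steps of [a :: s], then all those of
    [b :: t]; its shuffle sign is [1]. *)
Fixpoint stair (a : X) (s : seq X) (b : Y) (t : seq Y) : seq (X * Y) :=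
  (a, b) :: if s is a' :: s' then stair a' s' b t else [seq (a, y) | y <- t].

Lemma size_stair a s b t : size (stair a s b t) = (size s + size t).+1.
Proof. by elim: s a => [|x s IH] a /=; rewrite ?size_map // IH. Qed.

Lemma stair_head a s b t : stair a s b t = (a, b) :: behead (stair a s b t).
Proof. by case: s. Qed.

Lemma cross_stair c a s b t : stutter_free (a :: s) -> stutter_free (b :: t) ->
  cross c (stair a s b t) = c (a :: s) (b :: t).
Proof.
move=> sa tb; elim: s a sa c => [|x s IH] a /= sa c.
  elim: t b tb c {sa} => [|y t IH] b /= tb c //=.
  move: tb => /andP[yb ty]; rewrite cross_cons /xstep /ystep /= yb eqxx /=.
  by rewrite IH // /yslice /= expr2 mulrNN !mul1r.
move: sa => /andP[ax sx]; rewrite stair_head cross_cons /xstep /= ax eqxx /=.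
by rewrite -stair_head IH.
Qed.

Definition steplike_supp w :=
  forall z1 u v z2, ~~ xstep u v -> ~~ ystep u v -> w (z1 ++ [:: u, v & z2]) = 0.

(** The shuffle sign changes when a corner of the lattice path is flipped. *)
Definition flip_anti w := forall z1 z2 a a' b b', a != a' -> b != b' ->
  w (z1 ++ [:: (a, b), (a', b), (a', b') & z2]) =
  - w (z1 ++ [:: (a, b), (a, b'), (a', b') & z2]).

Definition unshuffle w : seq X -> seq Y -> R := fun s t =>
  match s, t with a :: s', b :: t' => w (stair a s' b t') | _, _ => 0 end.

Lemma steplike_cons w u : steplike_supp w -> steplike_supp (fun z => w (u :: z)).
Proof. by move=> w0 z1; apply: (w0 (u :: z1)). Qed.

Lemma flip_cons w u : flip_anti w -> flip_anti (fun z => w (u :: z)).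
Proof. by move=> w0 z1; apply: (w0 (u :: z1)). Qed.

(** Moving a step in the second direction from the end of [s] to its front takes
    one corner flip per step of [s]. *)
Lemma flip_stair w a s b b' t : steplike_supp w -> flip_anti w -> b != b' ->
  w (stair a s b (b' :: t)) = (-1) ^+ size s * w ((a, b) :: stair a s b' t).
Proof.
move=> ws wf bb'; elim: s a w ws wf => [|x s IH] a w ws wf /=.
  by rewrite mul1r.
rewrite (IH x _ (steplike_cons (a, b) ws) (flip_cons (a, b) wf)).
rewrite [stair x s b' t]stair_head.
have [<-{x}|ax] := eqVneq a x.
  have N (y : Y) : ~~ xstep (a, y) (a, y) /\ ~~ ystep (a, y) (a, y).
    by rewrite /xstep /ystep /= !eqxx.
  have [N1 N2] := N b; have [N3 N4] := N b'.
  rewrite (ws [::] (a, b) (a, b)) // (ws [:: (a, b)] (a, b') (a, b')) //.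
  by rewrite !mulr0.
by rewrite (wf [::]) // exprS; ring.
Qed.

(** Corner flips relate any two lattice paths with the same projections, so the
    values on staircases determine the function. *)
Lemma cross_unshuffle w u z : steplike_supp w -> flip_anti w ->
  w (u :: z) = cross (unshuffle w) (u :: z).
Proof.
elim: z u w => [|v z IH] [a b] w ws wf; first by [].
have IH' := IH v _ (steplike_cons (a, b) ws) (flip_cons (a, b) wf).
rewrite cross_cons; case: ifP => [/andP[/= av /eqP /= bv]|xv].
  by rewrite IH'; apply: eq_cross => s t _ _; rewrite /xslice /= bv.
case: ifP => [/andP[/= /eqP av bv]|yv]; last by apply: (ws [::]); rewrite ?xv ?yv.
rewrite IH'; apply: eq_cross => s t _ _; rewrite /yslice /= -av.
rewrite flip_stair // mulrA -exprD.
have -> : ((size s).+2 + size s = (size s).+1.*2)%N by rewrite -addnn; lia.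
by rewrite -mul2n exprM sqrrN expr1n expr1n mul1r.
Qed.
End Stair.

Arguments seq_sum : simpl never.

(** * Boundary-closed functions on a product digraph *)

Lemma allowed_regular (G : digraph) (s : seq G) : allowed s -> regular s.
Proof.
apply: sub_sorted => x y xy; apply/negP => /eqP e.
by move: xy; rewrite e arrow_irr.
Qed.

Lemma path_stair (X Y : finType) (e : rel (X * Y)) (eX : rel X) (eY : rel Y)
    (eXP : forall a a' b, e (a, b) (a', b) = eX a a')
    (eYP : forall a b b', e (a, b) (a, b') = eY b b') a s b t :
  sorted e (stair a s b t) = path eX a s && path eY b t.
Proof.
elim: s a => [|x s IH] a; last first.
  rewrite -[LHS]/(path e (a, b) (stair x s b t)) /= -andbA -IH.
  by rewrite stair_head /= eXP.
by elim: t b => //= y t IH b; rewrite eYP IH.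
Qed.

Section OmegaFun.
Variable R : comNzRingType.

(** The coefficient functions of the elements of [Omega p], as characterized by
    [OmegaP]. *)
Record omega (G : digraph) (p : nat) (f : seq G -> R) : Prop := {
  omega_size : forall s, size s != p.+1 -> f s = 0;
  omega_allowed : forall s, ~~ allowed s -> f s = 0;
  omega_bd : forall s, regular s -> ~~ allowed s -> bd f s = 0 }.

Lemma omega_regular (G : digraph) p (f : seq G -> R) s :
  omega p f -> ~~ regular s -> f s = 0.
Proof.
by move=> fO Ns; apply: (omega_allowed fO); apply: contra Ns; apply: allowed_regular.
Qed.

(** If [s] is not allowed, prepending any vertex gives a path that is not
    allowed either; so the boundary of the slice at [s] is, up to sign, that of
    [f] at [x :: s].  When [x] is the first vertex of [s] the latter path is not
    regular, but then every insertion contributes zero. *)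
Lemma omega_slice (G : digraph) p (f : seq G -> R) x :
  omega p.+1 f -> omega p (fun s => f (x :: s)).
Proof.
move=> fO; split=> [s sp|s Ns|s rs Ns].
- exact: (omega_size fO).
- apply: (omega_allowed fO); apply: contra Ns.
  by case: s => //= y s /andP[].
have f0 c : f (c :: s) = 0.
  apply: (omega_allowed fO); apply: contra Ns.
  by case: s {rs} => //= y s /andP[].
case: s rs Ns f0 => [//|y s] rs Ns f0.
have [xy|xy] := eqVneq x y; last first.
  have := omega_bd fO (s := [:: x, y & s]).
  rewrite bd_cons big1 ?add0r => [b0|c _]; last first.
    apply: (omega_allowed fO); apply: contra Ns => /=.
    by case/and3P.
  apply/eqP; rewrite -oppr_eq0; apply/eqP/b0; first by rewrite /regular /= xy.
  by apply: contra Ns => /= /andP[].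
rewrite bd_cons big1 => [|c _]; last first.
  by apply: (omega_allowed fO); apply: contra Ns => /= /and3P[_ _ ->].
rewrite bd0 ?subr0 // => t.
by apply: (omega_regular fO); rewrite /regular /= xy eqxx.
Qed.

Lemma omega_vanish (G : digraph) p :
  (forall f : seq G -> R, omega p f -> f = fun=> 0) ->
  forall f : seq G -> R, omega p.+1 f -> f = fun=> 0.
Proof.
move=> O0 f fO; apply/funext => -[|x s]; first exact: (omega_size fO).
exact: (congr1 (fun h => h s) (O0 _ (omega_slice x fO))).
Qed.

Section Product.
Variables X Y : digraph.
Implicit Types (c : seq X -> seq Y -> R) (w : seq (cart X Y) -> R).

Lemma cart_arrow_steps (u v : cart X Y) : cart_arrow u v ->
  xstep u v && arrow u.1 v.1 || ystep u v && arrow u.2 v.2.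
Proof.
rewrite /cart_arrow /xstep /ystep => /orP[/andP[-> e]|/andP[e ->]].
  by rewrite e /= andbT; case: eqP e => //= ->; rewrite arrow_irr.
by rewrite e /= !andbT; case: eqP e => //= ->; rewrite arrow_irr.
Qed.

Lemma arrow_x (u v : cart X Y) : xstep u v -> cart_arrow u v = arrow u.1 v.1.
Proof.
move=> /andP[/negPf uv /eqP e].
by rewrite /cart_arrow uv e eqxx andbT.
Qed.

Lemma arrow_y (u v : cart X Y) : ystep u v -> cart_arrow u v = arrow u.2 v.2.
Proof.
move=> /andP[/eqP e /negPf uv].
by rewrite /cart_arrow uv e eqxx andbF orbF.
Qed.

(** A lattice path both of whose projections are allowed is itself allowed. *)
Lemma cross_nallowed c (z : seq (cart X Y)) :
  (forall s t, regular s -> regular t -> ~~ (allowed s && allowed t) ->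
     c s t = 0) -> ~~ allowed z -> cross c z = 0.
Proof.
case: z => [//|u z] c0.
have {}c0 s t : regular (u.1 :: s) -> regular (u.2 :: t) ->
    ~~ (path arrow u.1 s && path arrow u.2 t) -> c (u.1 :: s) (u.2 :: t) = 0.
  by move=> *; apply: c0.
rewrite /allowed /=.
elim: z u c c0 => [|v z IH] u c c0 //= Nz.
rewrite cross_cons; have [xuv|Nx] := boolP (xstep u v).
  have /andP[uv /eqP e] := xuv.
  move: Nz; rewrite negb_and (arrow_x xuv).
  have [auv|Nuv _] := boolP (arrow u.1 v.1).
    move=> /= Nz; apply: IH Nz => s t rs rt st; rewrite /xslice -e; apply: c0 => //.
    - by rewrite /regular /= uv.
    - by rewrite e.
    - by rewrite /= auv e.
  rewrite -(cross0 _ (v :: z)); apply: eq_cross => s t rs rt; rewrite /xslice -e.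
  apply: c0.
    - by rewrite /regular /= uv.
    - by rewrite e.
    - by rewrite /= (negPf Nuv).
have [yuv|Ny //] := boolP (ystep u v).
have /andP[/eqP e uv] := yuv.
move: Nz; rewrite negb_and (arrow_y yuv).
have [auv|Nuv _] := boolP (arrow u.2 v.2).
  move=> /= Nz; apply: IH Nz => s t rs rt st; rewrite /yslice -e c0 ?mulr0 //.
  - by rewrite e.
  - by rewrite /regular /= uv.
  - by rewrite /= auv e.
rewrite -(cross0 _ (v :: z)); apply: eq_cross => s t rs rt; rewrite /yslice -e.
rewrite c0 ?mulr0 //.
  - by rewrite e.
  - by rewrite /regular /= uv.
  - by rewrite /= (negPf Nuv) andbF.
Qed.

Lemma cross_size c (z : seq (cart X Y)) :
  (forall s t, (size s + size t)%N = (size z).+1 -> c s t = 0) -> cross c z = 0.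
Proof.
elim: z c => [//|u [|v z] IH] c c0; first by rewrite cross1 c0.
rewrite cross_cons; case: ifP => _.
  by apply: IH => s t st; apply: c0; rewrite /= addSn st.
case: ifP => // _.
by apply: IH => s t st; rewrite /yslice c0 ?mulr0 //= addnS st.
Qed.

Definition tensor (f : seq X -> R) (g : seq Y -> R) : seq X -> seq Y -> R :=
  fun s t => f s * g t.

Lemma omega_regular_supp p q f g : omega p f -> omega q g -> regular_supp (tensor f g).
Proof.
move=> fO gO s t; rewrite negb_and => /orP[] N; rewrite /tensor.
  by rewrite (omega_regular fO N) mul0r.
by rewrite (omega_regular gO N) mulr0.
Qed.

Lemma bd_total_tensor f g s t :
  bd_total (tensor f g) s t = bd f s * g t + (-1) ^+ (size s).+1 * f s * bd g t.
Proof.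
rewrite /bd_total /tensor bdZ -mulrA; congr (_ + _).
by under eq_bd do rewrite mulrC; rewrite bdZ mulrC.
Qed.

Lemma omega_cross p q f g : omega p f -> omega q g ->
  omega (p + q) (cross (tensor f g) : seq (cart X Y) -> R).
Proof.
move=> fO gO; have N := omega_regular_supp fO gO; split=> [z zs|z|z rz Nz].
- apply: cross_size => s t st; rewrite /tensor.
  have [sp|sp] := eqVneq (size s) p.+1; last by rewrite (omega_size fO sp) mul0r.
  have [tq|tq] := eqVneq (size t) q.+1; last by rewrite (omega_size gO tq) mulr0.
  by case/eqP: zs; move: st; rewrite sp tq; lia.
- apply: cross_nallowed => s t _ _; rewrite negb_and /tensor => /orP[] Ns.
    by rewrite (omega_allowed fO Ns) mul0r.
  by rewrite (omega_allowed gO Ns) mulr0.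
case: z rz Nz => [//|u z] rz Nz; rewrite bd_cross //.
apply: cross_nallowed Nz => s t rs rt; rewrite negb_and bd_total_tensor => /orP[] Ns.
  by rewrite (omega_allowed fO Ns) (omega_bd fO rs Ns) mulr0 !mul0r addr0.
by rewrite (omega_allowed gO Ns) (omega_bd gO rt Ns) !mulr0 addr0.
Qed.

Variables (r : nat) (w : seq (cart X Y) -> R).
Hypothesis wO : omega r w.

Lemma omega_steplike : steplike_supp w.
Proof.
move=> z1 u v z2 xuv yuv; apply: (omega_allowed wO); apply/negP.
rewrite /allowed; rewrite sorted_cat_cons => /andP[_ /= /andP[uv _]].
by have := cart_arrow_steps uv; rewrite (negPf xuv) (negPf yuv).
Qed.

(** The boundary of [w] at a path with a diagonal step is zero, since such a
    path is not allowed; its only terms are the two ways around the square. *)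
Lemma omega_flip : flip_anti w.
Proof.
move=> z1 z2 a a' b b' aa bb.
have Nab : (a, b) != (a', b') by rewrite xpair_eqE (negPf aa).
have Nx : ~~ xstep (a, b) (a', b') by rewrite /xstep /= (negPf bb) andbF.
have Ny : ~~ ystep (a, b) (a', b') by rewrite /ystep /= (negPf aa).
have [rz|Nz] := boolP (regular (z1 ++ [:: (a, b), (a', b') & z2] : seq (cart X Y))).
  have := omega_bd wO rz.
  rewrite (bd_gap (u := (a, b))) => [b0|t1 t2]; last exact: omega_steplike.
  have {b0} : \sum_x w (z1 ++ [:: (a, b), x, (a', b') & z2]) = 0.
    set e := (-1) ^+ (size z1).+1 in b0.
    rewrite -[LHS]mul1r (_ : 1 = e * e); last by rewrite -expr2 sqrr_sign.
    rewrite -mulrA b0 ?mulr0 //; apply/negP.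
    rewrite /allowed sorted_cat_cons => /andP[_ /= /andP[uv _]].
    by have := cart_arrow_steps uv; rewrite (negPf Nx) (negPf Ny).
  rewrite (sum_steps (u := (a', b'))) /= => [|v xv yv]; last first.
    rewrite -[_ :: _]/([:: (a, b)] ++ [:: v, (a', b') & z2]) catA.
    exact: omega_steplike.
  rewrite (bigD1 a) //= big1 => [|x /andP[xa' xa]].
    rewrite (bigD1 b) //= big1 => [|y /andP[yb' yb]].
      by rewrite !addr0 addrC => /eqP; rewrite addr_eq0 => /eqP.
    by apply: omega_steplike;
      rewrite /xstep /ystep /= ?(negPf aa) // (eq_sym b) (negPf yb) andbF.
  by apply: omega_steplike;
    rewrite /xstep /ystep /= ?(negPf bb) ?andbF // (eq_sym a) (negPf xa).
have W0 x : w (z1 ++ [:: (a, b), x, (a', b') & z2]) = 0.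
  apply: (omega_regular wO); apply: contra Nz.
  rewrite /regular !sorted_cat_cons => /andP[-> /= /and3P[_ _ ->]].
  by rewrite Nab.
by rewrite !W0 oppr0.
Qed.

Lemma cross_unshuffle_omega : w = cross (unshuffle w).
Proof.
apply/funext => -[|u z]; first exact: (omega_size wO).
exact: (cross_unshuffle u z omega_steplike omega_flip).
Qed.

Lemma allowed_stair a s b t : allowed (stair a s b t : seq (cart X Y)) =
  allowed (a :: s) && allowed (b :: t).
Proof.
apply: path_stair => [x x' y|x y y']; rewrite {1}/arrow /= /cart_arrow /=.
  by rewrite eqxx andbT arrow_irr andbF.
by rewrite eqxx arrow_irr orbF.
Qed.

Lemma regular_stair a s b t : regular (stair a s b t : seq (cart X Y)) =
  regular (a :: s) && regular (b :: t).
Proof.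
by apply: path_stair => [x x' y|x y y']; rewrite xpair_eqE eqxx ?andbT.
Qed.

Lemma unshuffle_size s t : (size s + size t)%N != r.+2 -> unshuffle w s t = 0.
Proof.
case: s t => [|a s] [|b t] //= st; apply: (omega_size wO).
by rewrite size_stair; apply: contra st => /eqP; rewrite addSn addnS => ->.
Qed.

Lemma unshuffle_allowed s t : ~~ (allowed s && allowed t) -> unshuffle w s t = 0.
Proof.
case: s t => [|a s] [|b t] //= st; apply: (omega_allowed wO).
by rewrite allowed_stair.
Qed.

Lemma regular_supp_unshuffle : regular_supp (unshuffle w).
Proof.
move=> s t; rewrite negb_and => N; apply: unshuffle_allowed; rewrite negb_and.
by case/orP: N => N; apply/orP; [left|right]; apply: contra N; apply: allowed_regular.
Qed.

(** The value at [s], [t] is that of the boundary of [w] at the staircase path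
    through [s] and [t], which is not allowed. *)
Lemma bd_total_unshuffle s t : regular s -> regular t ->
  s != [::] -> t != [::] -> ~~ (allowed s && allowed t) ->
  bd_total (unshuffle w) s t = 0.
Proof.
case: s t => [|a s] [|b t] // rs rt _ _ N.
rewrite -(cross_stair (bd_total (unshuffle w)) rs rt) stair_head.
rewrite -bd_cross -?stair_head; first last.
- by have := regular_stair a s b t; rewrite rs rt.
- exact: regular_supp_unshuffle.
rewrite -cross_unshuffle_omega (omega_bd wO) //; last by rewrite allowed_stair.
by rewrite regular_stair rs.
Qed.

Lemma unshuffle_col q t : size t = q.+1 -> (q <= r)%N ->
  omega (r - q) (fun s => unshuffle w s t).
Proof.
move=> tq qr; split=> [s sp|s Ns|s rs Ns].
- apply: unshuffle_size; apply: contra sp => /eqP; rewrite tq; lia.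
- by apply: unshuffle_allowed; rewrite (negPf Ns).
have [rt|Nt] := boolP (regular t); last first.
  by rewrite bd0 // => s'; apply: regular_supp_unshuffle; rewrite negb_and Nt orbT.
have := bd_total_unshuffle rs rt; rewrite (negPf Ns) /bd_total.
rewrite [X in _ + _ * X]bd0 => [|t']; last by apply: unshuffle_allowed;
  rewrite (negPf Ns).
rewrite mulr0 addr0; apply => //; first by apply: contra Ns => /eqP ->.
by apply/eqP => t0; rewrite t0 in tq.
Qed.

Lemma unshuffle_row p s : size s = p.+1 -> (p <= r)%N ->
  omega (r - p) (unshuffle w s).
Proof.
move=> sp pr; split=> [t tq|t Nt|t rt Nt].
- apply: unshuffle_size; apply: contra tq => /eqP; rewrite sp; lia.
- by apply: unshuffle_allowed; rewrite (negPf Nt) andbF.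
have [rs|Ns] := boolP (regular s); last first.
  by rewrite bd0 // => s'; apply: regular_supp_unshuffle; rewrite negb_and Ns.
have := bd_total_unshuffle rs rt; rewrite (negPf Nt) andbF /bd_total.
rewrite bd0 => [|t']; last by apply: unshuffle_allowed; rewrite (negPf Nt) andbF.
rewrite add0r => /(_ _ _ isT) b0; set e := (-1) ^+ (size s).+1 in b0.
rewrite -[LHS]mul1r (_ : 1 = e * e); last by rewrite -expr2 sqrr_sign.
rewrite -mulrA b0 ?mulr0 //; first by apply/eqP => s0; rewrite s0 in sp.
by apply: contra Nt => /eqP ->.
Qed.
End Product.
End OmegaFun.

Section OmegaSums.
Variables (R : comNzRingType) (X Y : digraph).

Lemma seq_sum_cross_tensor (c : seq X -> seq Y -> R) p q f g :
  regular_supp c -> omega p f -> omega q g ->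
  seq_sum (p + q).+1 (fun z => cross c z * cross (tensor f g) z) =
  'C(p + q, p)%:R *
    seq_sum p.+1 (fun s => f s * seq_sum q.+1 (fun t => c s t * g t)).
Proof.
move=> c0 fO gO; rewrite seq_sum_cross //; last exact: omega_regular_supp fO gO.
have pr : (p < (p + q).+1)%N by rewrite ltnS leq_addr.
rewrite (bigD1 (Ordinal pr)) //= [X in _ + X = _]big1 ?addr0 => [|i ip].
  rewrite addKn; congr (_ * _); apply: eq_seq_sum => s _; rewrite -seq_sumZ.
  by apply: eq_seq_sum => t _; rewrite /tensor; ring.
rewrite [X in _ * X](_ : _ = 0) ?mulr0 //; apply: (seq_sum0 (n := i.+1)) => s sp.
apply: (seq_sum0 (n := (p + q - i).+1)) => t _.
rewrite /tensor (omega_size fO) ?mul0r ?mulr0 // sp eqSS.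
by apply: contra ip => /eqP e; apply/eqP/val_inj.
Qed.

Lemma omega_seq_sum (G : digraph) p n (F : seq Y -> seq G -> R) (k : seq Y -> R) :
  (forall t, size t = n -> omega p (F t)) ->
  omega p (fun s => seq_sum n (fun t => F t s * k t)).
Proof.
move=> FO; split=> [s sp|s Ns|s rs Ns].
- by apply: seq_sum0 => t tn; rewrite (omega_size (FO t tn) sp) mul0r.
- by apply: seq_sum0 => t tn; rewrite (omega_allowed (FO t tn) Ns) mul0r.
under eq_bd do rewrite seq_sum_tuple.
rewrite bd_sum big1 // => t _; under eq_bd do rewrite mulrC.
by rewrite bdZ (omega_bd (FO t (size_tuple t)) rs Ns) mulr0.
Qed.
End OmegaSums.

(** * Completeness of the cross products *)

Section Orthogonal.
Variable R : realDomainType.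

Lemma seq_sum_sqr0 (V : finType) n (f : seq V -> R) s :
  seq_sum n (fun t => f t * f t) = 0 -> size s = n -> f s = 0.
Proof.
rewrite seq_sum_tuple => /eqP; rewrite psumr_eq0 => [/allP f0 sn|t _]; last first.
  by rewrite -expr2 sqr_ge0.
have := f0 (Tuple (introT eqP sn)) (mem_index_enum _).
by rewrite mulf_eq0 orbb => /eqP.
Qed.

(** Write [w] as the cross product of [c].  For fixed [s], the function [c s]
    belongs to [Omega] of [Y], and contracting [c] with it along [Y] gives a
    function [h] in [Omega] of [X].  Orthogonality to the cross product of [h]
    and [c s] says that the norm of [h] is zero, and then [h s], which is the
    squared norm of [c s], is zero. *)
Lemma omega_cross_orth (X Y : digraph) r (w : seq (cart X Y) -> R) :
  omega r w ->
  (forall p q f g, (p + q)%N = r -> omega p f -> omega q g ->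
     seq_sum r.+1 (fun z => w z * cross (tensor f g) z) = 0) ->
  forall z, w z = 0.
Proof.
move=> wO orth z; rewrite (cross_unshuffle_omega wO).
apply: cross_size => s t st.
have [|Nsz] := eqVneq (size s + size t)%N r.+2; last exact: (unshuffle_size wO Nsz).
case: s {st} => [//|a s'] /=; set s := a :: s'; case: t => [|b t'] /=.
  by [].
set t := b :: t' => st; set p := size s'; set q := size t'.
have pq : (p + q)%N = r by move: st; rewrite addSn addnS => -[].
have pr : (p <= r)%N by rewrite -pq leq_addr.
have qr : (q <= r)%N by rewrite -pq leq_addl.
have ep : (r - q)%N = p by rewrite -pq addnK.
have eq : (r - p)%N = q by rewrite -pq addKn.
pose c := unshuffle w.
have gO : omega q (c s) by rewrite -eq; apply: unshuffle_row.
(* its value at s is the squared norm of c s *)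
pose h s1 := seq_sum q.+1 (fun t1 => c s1 t1 * c s t1).
have hO : omega p h.
  apply: (omega_seq_sum (F := fun t1 s1 => c s1 t1)) => t1 t1q.
  by rewrite -ep; apply: (unshuffle_col wO).
have : seq_sum (p + q).+1 (fun z => cross c z * cross (tensor h (c s)) z) = 0.
  by rewrite /c -(cross_unshuffle_omega wO) pq; apply: orth pq hO gO.
rewrite seq_sum_cross_tensor //; last exact: (regular_supp_unshuffle wO).
move/eqP; rewrite mulf_eq0 pnatr_eq0 -leqn0 leqNgt bin_gt0 leq_addr /= => /eqP.
move/(seq_sum_sqr0 (s := s)) => /(_ erefl).
by move/(seq_sum_sqr0 (s := t)) => /(_ erefl).
Qed.
End Orthogonal.

(** * Chains as functions of sequences *)

Lemma bd_size (R : comNzRingType) (V : finType) (f : seq V -> R) s :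
  (forall t, size t = (size s).+1 -> f t = 0) -> bd f s = 0.
Proof.
elim: s f => [|y s IH] f f0 /=.
  by rewrite subr0 big1 // => x _; apply: f0.
rewrite IH ?subr0 => [|t ts]; last by apply: f0; rewrite /= ts.
by rewrite big1 // => x _; apply: f0.
Qed.

Section Eval.
Variables (R : realType) (G : digraph).

(** The coefficient of [u] at an arbitrary sequence, zero unless the sequence is a
    regular [p]-path. *)
Definition ev p (u : chain R G p) (s : seq G) : R :=
  \sum_(t : rpath G p | rpath_seq t == s) u t.

Definition chain_of p (f : seq G -> R) : chain R G p := [ffun t => f (rpath_seq t)].

Lemma rpath_seqP p (t : rpath G p) :
  (size (rpath_seq t) == p.+1) && regular (rpath_seq t).
Proof. by rewrite size_tuple eqxx (valP t). Qed.

Lemma rpath_seq_inj p : injective (@rpath_seq G p).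
Proof. by move=> t t' e; apply/val_inj/val_inj. Qed.

Lemma ev_rpath p (u : chain R G p) t : ev u (rpath_seq t) = u t.
Proof.
by rewrite /ev (big_pred1 t) // => t'; rewrite (inj_eq (@rpath_seq_inj p)).
Qed.

Lemma rpath_of p (s : seq G) : (size s == p.+1) && regular s ->
  exists t : rpath G p, rpath_seq t = s.
Proof. by case/andP => sp rs; exists (Sub (Tuple sp) rs). Qed.

Lemma ev_out p (u : chain R G p) s : ~~ ((size s == p.+1) && regular s) ->
  ev u s = 0.
Proof.
move=> N; rewrite /ev big1 // => t /eqP ts; case/negP: N.
by rewrite -ts rpath_seqP.
Qed.

Lemma ev_lin p a (u v : chain R G p) s : ev (a *: u + v) s = a * ev u s + ev v s.
Proof.
by rewrite /ev mulr_sumr -big_split; apply: eq_bigr => t _; rewrite !ffunE.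
Qed.

Lemma ev_inj p (u v : chain R G p) : ev u =1 ev v -> u = v.
Proof. by move=> uv; apply/ffunP => t; rewrite -!ev_rpath. Qed.

Lemma ev_sum p (I : Type) (r : seq I) (F : I -> chain R G p) s :
  ev (\sum_(i <- r) F i) s = \sum_(i <- r) ev (F i) s.
Proof.
rewrite /ev exchange_big; apply: eq_bigr => t _; exact: sum_ffunE.
Qed.

Lemma evZ p a (u : chain R G p) s : ev (a *: u) s = a * ev u s.
Proof. by rewrite /ev mulr_sumr; apply: eq_bigr => t _; rewrite !ffunE. Qed.

Lemma ev_chain_of p (f : seq G -> R) :
  (forall s, ~~ ((size s == p.+1) && regular s) -> f s = 0) ->
  ev (chain_of p f) =1 f.
Proof.
move=> f0 s; have [/rpath_of[t <-]|N] := boolP ((size s == p.+1) && regular s).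
  by rewrite ev_rpath ffunE.
by rewrite ev_out // f0.
Qed.

Lemma ev_elem p (t : seq G) s : (size s == p.+1) && regular s ->
  ev (elem R p t) s = (t == s)%:R.
Proof. by case/rpath_of => t' <-; rewrite ev_rpath ffunE eq_sym. Qed.

Lemma ev_boundary p (u : chain R G p) s : s != [::] -> regular s ->
  ev (boundary R G p u) s = bd (ev u) s.
Proof.
case: p u => [|p] u s0 rs.
  rewrite boundary0 lfunE /= bd_size => [|t ts].
    by rewrite /ev big1 // => t _; rewrite ffunE.
  by rewrite ev_out // ts eqSS; case: s s0 {rs ts}.
have [sp|sp] := eqVneq (size s) p.+1; last first.
  rewrite ev_out ?(negPf sp) // bd_size // => t ts.
  by rewrite ev_out // ts eqSS (negPf sp).
have sr : (size s == p.+1) && regular s by rewrite sp eqxx.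
rewrite {1}[u]chain_elem linear_sum /= ev_sum.
transitivity (\sum_(t : rpath G p.+1) u t * bd (fun t' => (rpath_seq t == t')%:R) s).
  apply: eq_bigr => t _; rewrite linearZ /= evZ boundary_elem ev_sum.
  have st : size (rpath_seq t) = p.+2 by case/andP: (rpath_seqP t) => /eqP.
  rewrite bd_delta ?st ?sp //; congr (_ * _); apply: eq_bigr => k _.
  by rewrite evZ ev_elem.
under eq_bigr do rewrite -bdZ.
rewrite -bd_sum; apply: eq_bd => t.
rewrite /ev [RHS]big_mkcond /=; apply: eq_bigr => t' _.
by case: eqP => _; rewrite ?mulr1 ?mulr0.
Qed.

Lemma allowed_spaceP p (u : chain R G p) :
  reflect (forall s, ~~ allowed s -> ev u s = 0) (u \in allowed_space R G p).
Proof.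
apply: (iffP idP) => [uA s Ns|u0].
  rewrite (coord_span (X := in_tuple _) uA).
  rewrite ev_sum big1 // => i _; rewrite evZ.
  have [sr|N] := boolP ((size s == p.+1) && regular s); last by rewrite ev_out ?mulr0.
  have /mapP[t] := mem_nth 0 (ltn_ord i); rewrite mem_enum inE => at_ ->.
  rewrite ev_elem //; case: eqP => [ts|_]; last by rewrite mulr0.
  by rewrite -ts at_ in Ns.
rewrite [u]chain_elem; apply: rpred_sum => t _.
have [at_|Nt] := boolP (allowed (rpath_seq t)).
  by apply/rpredZ/memv_span/map_f; rewrite mem_enum.
by rewrite -ev_rpath u0 // scale0r mem0v.
Qed.

Lemma OmegaP p (u : chain R G p) : reflect (omega p (ev u)) (u \in Omega R G p).
Proof.
rewrite memv_cap -memv_preim;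
  apply: (iffP andP) => [[/allowed_spaceP uA /allowed_spaceP bA]|uO].
  split=> [s sp|//|s rs Ns]; first by rewrite ev_out // (negPf sp).
  by rewrite -ev_boundary // ?bA //; apply: contra Ns => /eqP ->.
split; apply/allowed_spaceP; first exact: omega_allowed uO.
move=> s Ns; have [rs|Nr] := boolP (regular s);
  last by rewrite ev_out // negb_and Nr orbT.
rewrite ev_boundary ?(omega_bd uO) //.
by apply: contra Ns => /eqP ->.
Qed.

Definition oev p (u : subvs_of (Omega R G p)) : seq G -> R := ev (vsval u).
(** Projecting by [vsproj] avoids carrying a proof of membership in [Omega]; for
    functions satisfying [omega] nothing is lost ([oev_omega_of]). *)
Definition omega_of p (f : seq G -> R) : subvs_of (Omega R G p) :=
  vsproj (Omega R G p) (chain_of p f).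

Lemma oev_omega p (u : subvs_of (Omega R G p)) : omega p (oev u).
Proof. exact/OmegaP/subvsP. Qed.

Lemma oev_inj p (u v : subvs_of (Omega R G p)) : oev u =1 oev v -> u = v.
Proof. by move=> uv; apply/val_inj/ev_inj. Qed.

Lemma oev_lin p a (u v : subvs_of (Omega R G p)) s :
  oev (a *: u + v) s = a * oev u s + oev v s.
Proof. by rewrite /oev linearP ev_lin. Qed.

Lemma oev0 p s : oev (0 : subvs_of (Omega R G p)) s = 0.
Proof. by rewrite /oev linear0 /ev big1 // => t _; rewrite ffunE. Qed.

Lemma oev_out p (u : subvs_of (Omega R G p)) s : size s != p.+1 -> oev u s = 0.
Proof. by move=> sp; rewrite (omega_size (oev_omega u)). Qed.

Lemma oev_omega_of p f : omega p f -> oev (omega_of p f) =1 f.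
Proof.
move=> fO; have E : ev (chain_of p f) =1 f.
  apply: ev_chain_of => s; rewrite negb_and => /orP[N|N].
    exact: (omega_size fO).
  exact: (omega_regular fO).
move=> s; rewrite /oev vsprojK //; apply/OmegaP.
by rewrite (funext E).
Qed.

Lemma omega_of_lin p a (f g : seq G -> R) :
  omega_of p (fun s => a * f s + g s) = a *: omega_of p f + omega_of p g.
Proof.
rewrite /omega_of -linearP; congr (vsproj _ _).
by apply/ffunP => t; rewrite !ffunE.
Qed.

Lemma oev_d p (u : subvs_of (Omega R G p)) s : s != [::] -> regular s ->
  oev (dOmega R G p u) s = bd (oev u) s.
Proof. by move=> *; rewrite /oev dOmegaE ev_boundary. Qed.

Lemma dOmega0 (u : subvs_of (Omega R G 0)) : dOmega R G 0 u = 0.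
Proof.
by apply: oev_inj => s; rewrite oev0 /oev dOmegaE boundary0 lfunE /ev big1 // => t _;
  rewrite ffunE.
Qed.

Lemma dOmega_dOmega p (u : subvs_of (Omega R G p)) :
  dOmega R G p.-1 (dOmega R G p u) = 0.
Proof.
apply: oev_inj => s; rewrite oev0 /oev !dOmegaE boundaryK /ev big1 // => t _.
by rewrite ffunE.
Qed.

Lemma inner_seq_sum a p (u v : subvs_of (Omega R G p)) :
  inner a u v = (a p)^-1 * seq_sum p.+1 (fun s => oev u s * oev v s).
Proof.
congr (_ * _);
  rewrite seq_sum_tuple [RHS](bigID (fun t : p.+1.-tuple G => regular t)) /=.
rewrite [X in _ = _ + X]big1 ?addr0 => [|t Nt]; last first.
  by rewrite (omega_regular (oev_omega u) Nt) mul0r.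
rewrite (reindex_omap (val : rpath G p -> p.+1.-tuple G) insub) => [|t rt].
  apply: eq_big => [[t rt] /=|t _]; first by rewrite rt insubT eqxx.
  by rewrite /oev !ev_rpath.
by rewrite insubT.
Qed.
End Eval.

(** * The Laplacian of a cross product *)

Section CodOmega.
Variables (R : realType) (G : digraph) (a : nat -> R).
Hypothesis a_gt0 : forall p, 0 < a p.

Lemma inner_nondeg p (u : subvs_of (Omega R G p)) :
  (forall v, inner a u v = 0) -> u = 0.
Proof. by move=> u0; apply: (inner_eq0 a_gt0 (u0 u)). Qed.

Lemma innerDl p (u v w : subvs_of (Omega R G p)) :
  inner a (u + v) w = inner a u w + inner a v w.
Proof. by have := innerP a 1 u v w; rewrite scale1r mul1r. Qed.

Lemma innerZl p b (u w : subvs_of (Omega R G p)) :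
  inner a (b *: u) w = b * inner a u w.
Proof. by have := innerP a b u 0 w; rewrite addr0 (innerC _ 0) inner0 addr0. Qed.

Lemma innerDr p (u v w : subvs_of (Omega R G p)) :
  inner a w (u + v) = inner a w u + inner a w v.
Proof. by rewrite innerC innerDl !(innerC _ w). Qed.

Lemma innerZr p b (u w : subvs_of (Omega R G p)) :
  inner a w (b *: u) = b * inner a w u.
Proof. by rewrite innerC innerZl innerC. Qed.

Lemma codOmega_codOmega p (u : subvs_of (Omega R G p.-1)) :
  codOmega _ a p.+1 (codOmega _ a p u) = 0.
Proof.
apply: inner_nondeg => v; rewrite innerC -(codOmegaE a_gt0) -(codOmegaE a_gt0).
by rewrite dOmega_dOmega innerC inner0.
Qed.
End CodOmega.

Section CrossOmega.
Variables (R : realType) (X Y : digraph).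
Let a (q : nat) : R := q`!%:R.

Lemma fact_gt0R q : 0 < a q.
Proof. by rewrite ltr0n fact_gt0. Qed.

(** The degree [r] is a parameter of its own, meant to be [p + q] up to a proof,
    so that no casts between [Omega] spaces occur. *)
Definition crossO r p q (u : subvs_of (Omega R X p)) (v : subvs_of (Omega R Y q)) :
  subvs_of (Omega R (cart X Y) r) := omega_of (G := cart X Y) r (cross (tensor (oev u) (oev v))).

Lemma crossO_linl r p q b (u u' : subvs_of (Omega R X p))
    (v : subvs_of (Omega R Y q)) :
  crossO r (b *: u + u') v = b *: crossO r u v + crossO r u' v.
Proof.
rewrite /crossO -omega_of_lin; congr omega_of; apply/funext => z.
rewrite -cross_lin; congr cross; apply/funext => s; apply/funext => t.
by rewrite /tensor oev_lin mulrDl mulrA.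
Qed.

Lemma crossO_linr r p q b (u : subvs_of (Omega R X p))
    (v v' : subvs_of (Omega R Y q)) :
  crossO r u (b *: v + v') = b *: crossO r u v + crossO r u v'.
Proof.
rewrite /crossO -omega_of_lin; congr omega_of; apply/funext => z.
rewrite -cross_lin; congr cross; apply/funext => s; apply/funext => t.
by rewrite /tensor oev_lin mulrDr mulrCA.
Qed.

Lemma crossODl r p q (u u' : subvs_of (Omega R X p)) (v : subvs_of (Omega R Y q)) :
  crossO r (u + u') v = crossO r u v + crossO r u' v.
Proof. by have := crossO_linl r 1 u u' v; rewrite !scale1r. Qed.

Lemma crossODr r p q (u : subvs_of (Omega R X p)) (v v' : subvs_of (Omega R Y q)) :
  crossO r u (v + v') = crossO r u v + crossO r u v'.
Proof. by have := crossO_linr r 1 u v v'; rewrite !scale1r. Qed.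

Lemma crossO0l r p q (v : subvs_of (Omega R Y q)) :
  crossO r (0 : subvs_of (Omega R X p)) v = 0.
Proof.
have := crossO_linl r (-1) (0 : subvs_of (Omega R X p)) 0 v.
by rewrite scaler0 addr0 scaleN1r addNr.
Qed.

Lemma crossO0r r p q (u : subvs_of (Omega R X p)) :
  crossO r u (0 : subvs_of (Omega R Y q)) = 0.
Proof.
have := crossO_linr r (-1) u (0 : subvs_of (Omega R Y q)) 0.
by rewrite scaler0 addr0 scaleN1r addNr.
Qed.

Lemma crossOZl r p q b (u : subvs_of (Omega R X p)) (v : subvs_of (Omega R Y q)) :
  crossO r (b *: u) v = b *: crossO r u v.
Proof. by have := crossO_linl r b u 0 v; rewrite crossO0l !addr0. Qed.

Lemma crossOZr r p q b (u : subvs_of (Omega R X p)) (v : subvs_of (Omega R Y q)) :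
  crossO r u (b *: v) = b *: crossO r u v.
Proof. by have := crossO_linr r b u v 0; rewrite crossO0r !addr0. Qed.

Lemma oev_crossO r p q (u : subvs_of (Omega R X p)) (v : subvs_of (Omega R Y q)) :
  (p + q)%N = r -> oev (crossO r u v) =1 cross (tensor (oev u) (oev v)).
Proof. by move=> <-; apply/oev_omega_of/omega_cross; apply: oev_omega. Qed.

(** The inner product of weight [p!], but on functions, so that elements of
    different degrees can be paired. *)
Definition pairing (G : digraph) p (f g : seq G -> R) : R :=
  (a p)^-1 * seq_sum p.+1 (fun s => f s * g s).

Lemma pairingC (G : digraph) p (f g : seq G -> R) : pairing p f g = pairing p g f.
Proof. by congr (_ * _); apply: eq_seq_sum => s _; rewrite mulrC. Qed.

Lemma pairing0r (G : digraph) p (f : seq G -> R) q :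
  pairing p f (oev (0 : subvs_of (Omega R G q))) = 0.
Proof. by rewrite /pairing seq_sum0 ?mulr0 // => s _; rewrite oev0 mulr0. Qed.

Lemma pairing_inner (G : digraph) p (u v : subvs_of (Omega R G p)) :
  inner a u v = pairing p (oev u) (oev v).
Proof. exact: inner_seq_sum. Qed.

Lemma pairing_out (G : digraph) p p' (u : subvs_of (Omega R G p)) (g : seq G -> R) :
  p != p' -> pairing p' (oev u) g = 0.
Proof.
move=> pp; rewrite /pairing seq_sum0 ?mulr0 // => s sp.
by rewrite oev_out ?mul0r // sp eqSS eq_sym.
Qed.

(** The binomial coefficient counting the lattice paths is absorbed by the
    weights: [(p + q)! = binomial (p + q) p * p! * q!]. *)
Lemma inner_cross r p q p' q' (u : subvs_of (Omega R X p))
    (v : subvs_of (Omega R Y q)) (u' : subvs_of (Omega R X p'))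
    (v' : subvs_of (Omega R Y q')) :
  (p + q)%N = r -> (p' + q')%N = r ->
  inner a (crossO r u v) (crossO r u' v') =
  pairing p' (oev u) (oev u') * pairing q' (oev v) (oev v').
Proof.
move=> pq pq'; rewrite inner_seq_sum.
under eq_seq_sum => s _ do rewrite !oev_crossO //.
rewrite -pq' (seq_sum_cross_tensor (omega_regular_supp (oev_omega u) (oev_omega v))
  (oev_omega u') (oev_omega v')).
have -> : seq_sum p'.+1 (fun s => oev u' s *
     seq_sum q'.+1 (fun t => tensor (oev u) (oev v) s t * oev v' t)) =
   seq_sum p'.+1 (fun s => oev u s * oev u' s) * seq_sum q'.+1 (fun t => oev v t * oev v' t).
  rewrite mulrC -seq_sumZ; apply: eq_seq_sum => s _.
  rewrite /tensor -!seq_sumZ mulrC -seq_sumZ; apply: eq_seq_sum => t _; ring.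
rewrite /pairing /a -(bin_fact (leq_addr q' p')) addKn !natrM.
have C0 : ('C(p' + q', p'))%:R != 0 :> R by rewrite pnatr_eq0 -lt0n bin_gt0 leq_addr.
have P0 : (p'`!)%:R != 0 :> R by rewrite pnatr_eq0 -lt0n fact_gt0.
have Q0 : (q'`!)%:R != 0 :> R by rewrite pnatr_eq0 -lt0n fact_gt0.
by field; rewrite C0 P0 Q0.
Qed.

Lemma pairing_adj (G : digraph) p p' (u : subvs_of (Omega R G p))
    (u' : subvs_of (Omega R G p')) :
  pairing p'.-1 (oev u) (oev (dOmega R G p' u')) =
  pairing p' (oev (codOmega _ a p.+1 u)) (oev u').
Proof.
case: p' u' => [|p'] u'.
  rewrite [RHS]pairing_out // dOmega0 /pairing seq_sum0 ?mulr0 // => s _.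
  by rewrite oev0 mulr0.
have [pp|pp] := eqVneq p p'; last by rewrite !pairing_out ?eqSS.
case: p' / pp u' => u'.
have := codOmegaE fact_gt0R u' u.
by rewrite !inner_seq_sum -!/(pairing _ _ _) pairingC [RHS]pairingC.
Qed.

Lemma oev_crossO_dl r p q (u : subvs_of (Omega R X p)) (v : subvs_of (Omega R Y q)) :
  (p + q)%N = r ->
  oev (crossO r.-1 (dOmega R X p u) v) =1 cross (tensor (oev (dOmega R X p u)) (oev v)).
Proof.
case: p u => [|p] u pq; last by apply: oev_crossO; rewrite -pq.
move=> z; rewrite dOmega0 crossO0l oev0 -[LHS](cross0 _ z).
by congr cross; apply/funext => s; apply/funext => t; rewrite /tensor oev0 mul0r.
Qed.

Lemma oev_crossO_dr r p q (u : subvs_of (Omega R X p)) (v : subvs_of (Omega R Y q)) :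
  (p + q)%N = r ->
  oev (crossO r.-1 u (dOmega R Y q v)) =1 cross (tensor (oev u) (oev (dOmega R Y q v))).
Proof.
case: q v => [|q] v pq; last by apply: oev_crossO; rewrite -pq addnS.
move=> z; rewrite dOmega0 crossO0r oev0 -[LHS](cross0 _ z).
by congr cross; apply/funext => s; apply/funext => t; rewrite /tensor oev0 mulr0.
Qed.

Lemma dOmega_cross r p q (u : subvs_of (Omega R X p)) (v : subvs_of (Omega R Y q)) :
  (p + q)%N = r ->
  dOmega R _ r (crossO r u v) =
  crossO r.-1 (dOmega R X p u) v + (-1) ^+ p *: crossO r.-1 u (dOmega R Y q v).
Proof.
move=> pq; apply: oev_inj => z; rewrite addrC oev_lin oev_crossO_dl // oev_crossO_dr //.
case: z => [|x z]; first by rewrite oev_out ?mulr0 ?addr0.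
have [rz|Nz] := boolP (regular (x :: z)); last first.
  rewrite (omega_regular (oev_omega _) Nz) -(oev_crossO_dl u v pq) -(oev_crossO_dr u v pq).
  by rewrite !(omega_regular (oev_omega _) Nz) mulr0 addr0.
rewrite oev_d // (eq_bd _ (oev_crossO u v pq)) bd_cross //; last first.
  exact: omega_regular_supp (oev_omega u) (oev_omega v).
rewrite -cross_lin; apply: eq_cross => s t rs rt.
rewrite bd_total_tensor /tensor !oev_d // addrC; congr (_ + _); rewrite -mulrA.
have [sp|sp] := eqVneq (size (x.1 :: s)) p.+1; last by rewrite oev_out // !mul0r !mulr0.
by rewrite sp !exprS; ring.
Qed.

(** By completeness of the cross products it suffices to pair both sides with
    them, where adjointness turns the claim into the Leibniz rule. *)
Lemma codOmega_cross r p q (u : subvs_of (Omega R X p)) (v : subvs_of (Omega R Y q)) :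
  (p + q)%N = r ->
  codOmega _ a r.+1 (crossO r u v) =
  crossO r.+1 (codOmega _ a p.+1 u) v + (-1) ^+ p *: crossO r.+1 u (codOmega _ a q.+1 v).
Proof.
move=> pq; apply/eqP; rewrite -subr_eq0; apply/eqP; set w := _ - _.
apply: oev_inj => z; rewrite oev0; move: z.
apply: (omega_cross_orth (oev_omega w)) => p' q' f g pq' fO gO.
pose u' := omega_of p' f; pose v' := omega_of q' g.
suff: inner a w (crossO r.+1 u' v') = 0.
  rewrite inner_seq_sum => /eqP;
    rewrite mulf_eq0 invr_eq0 gt_eqF ?fact_gt0R //= => /eqP <-.
  apply: eq_seq_sum => z _; rewrite oev_crossO //; congr (_ * _).
  by congr cross; apply/funext => s; apply/funext => t; rewrite /tensor !oev_omega_of.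
have E1 : inner a (crossO r u v) (crossO r (dOmega R X p' u') v') =
    pairing p' (oev (codOmega _ a p.+1 u)) (oev u') * pairing q' (oev v) (oev v').
  rewrite -pairing_adj; case: p' u' pq' {fO} => [|p'] u' pq'.
    by rewrite dOmega0 crossO0l inner0 pairing0r mul0r.
  by rewrite (inner_cross _ _ _ _ pq) //; case: pq'.
have E2 : inner a (crossO r u v) (crossO r u' (dOmega R Y q' v')) =
    pairing p' (oev u) (oev u') * pairing q' (oev (codOmega _ a q.+1 v)) (oev v').
  rewrite -pairing_adj; case: q' v' pq' {E1 gO} => [|q'] v' pq'.
    by rewrite dOmega0 crossO0r inner0 pairing0r mulr0.
  by rewrite (inner_cross _ _ _ _ pq) //; move: pq'; rewrite addnS => -[].
rewrite /w innerDl -scaleN1r innerZl innerDl innerZl.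
rewrite [inner a (codOmega _ _ _ _) _]innerC -(codOmegaE fact_gt0R).
rewrite [inner a (dOmega _ _ _ _) _]innerC (dOmega_cross _ _ pq') innerDr innerZr E1 E2.
rewrite !inner_cross ?addSn ?addnS ?pq //.
have [pp|pp] := eqVneq p p'; last by rewrite [pairing p' (oev u) _]pairing_out //; ring.
by rewrite (congr1 (fun k => (-1) ^+ k : R) pp); ring.
Qed.

(** The mixed terms coming from boundary after coboundary and from coboundary
    after boundary have opposite signs. *)
Lemma laplacian_cross r p q (u : subvs_of (Omega R X p)) (v : subvs_of (Omega R Y q)) :
  (p + q)%N = r ->
  hodge_laplacian R _ a r (crossO r u v) =
  crossO r (hodge_laplacian R _ a p u) v + crossO r u (hodge_laplacian R _ a q v).
Proof.
move=> pq.
have lapE (G : digraph) k (x : subvs_of (Omega R G k)) : hodge_laplacian R G a k x =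
    dOmega R G k.+1 (codOmega _ a k.+1 x) + codOmega _ a k (dOmega R G k x).
  by rewrite /hodge_laplacian add_lfunE !comp_lfunE.
have dl : codOmega _ a r (crossO r.-1 (dOmega R X p u) v) =
    crossO r (codOmega _ a p (dOmega R X p u)) v -
    (-1) ^+ p *: crossO r (dOmega R X p u) (codOmega _ a q.+1 v).
  case: p u pq => [|p] u pq.
    by rewrite dOmega0 !(crossO0l, linear0) ?scaler0 ?subr0 ?addr0.
  case: r pq => // r [pq].
  by rewrite /= (codOmega_cross _ _ pq) exprS mulN1r scaleNr opprK.
have dr : codOmega _ a r (crossO r.-1 u (dOmega R Y q v)) =
    crossO r (codOmega _ a p.+1 u) (dOmega R Y q v) +
    (-1) ^+ p *: crossO r u (codOmega _ a q (dOmega R Y q v)).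
  case: q v pq {dl} => [|q] v pq.
    by rewrite dOmega0 !(crossO0r, linear0) ?scaler0 ?addr0.
  case: r pq => [|r]; rewrite addnS // => -[pq].
  by rewrite /= (codOmega_cross _ _ pq).
rewrite !lapE codOmega_cross // (dOmega_cross _ _ pq) !linearD !linearZ /= dl dr.
rewrite (dOmega_cross (p := p.+1)) ?addSn ?pq // (dOmega_cross (q := q.+1)) ?addnS ?pq //=.
rewrite crossODl crossODr !scalerDr !scalerA -expr2 sqrr_sign !scale1r.
rewrite exprS mulN1r scaleNr.
set A := (-1) ^+ p *: _; set B := (-1) ^+ p *: _; set C := crossO _ _ _;
  set D := crossO _ _ _.
rewrite addrACA [C - B + _]addrACA -opprD [A + D + _]addrACA [B + A]addrC.
by rewrite [LHS]addrA subrK.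
Qed.
End CrossOmega.

(** * Orthonormal eigenbases *)

Section Spectral.
Variables (R : realType) (U : vectType R) (ip : U -> U -> R).
Hypothesis ip_lin : forall a u v w, ip (a *: u + v) w = a * ip u w + ip v w.
Hypothesis ipC : forall u v, ip u v = ip v u.
Hypothesis ip_gt0 : forall u, u != 0 -> 0 < ip u u.

Lemma ip0l u : ip 0 u = 0.
Proof.
have := ip_lin (-1) 0 0 u; rewrite scaler0 addr0 mulN1r addNr; exact.
Qed.

Lemma ipZl a u v : ip (a *: u) v = a * ip u v.
Proof. by have := ip_lin a u 0 v; rewrite ip0l !addr0. Qed.

Lemma ipDl u v w : ip (u + v) w = ip u w + ip v w.
Proof. by have := ip_lin 1 u v w; rewrite scale1r mul1r. Qed.

Lemma ip_suml (I : Type) (r : seq I) (P : pred I) (F : I -> U) v :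
  ip (\sum_(i <- r | P i) F i) v = \sum_(i <- r | P i) ip (F i) v.
Proof.
by apply: (big_morph (ip^~ v)) => [x y|]; [exact: ipDl|exact: ip0l].
Qed.

(** A kernel, so that it is a [{vspace U}] and can be intersected with
    an invariant subspace. *)
Definition ip_orth u : {vspace U} :=
  let f := fun v => ip v u : R^o in
  let f_lin : linear f := fun a x y => ip_lin a x y u in
  let F : {linear U -> R^o} := HB.pack f (GRing.isLinear.Build R U R^o _ f f_lin) in
  lker (linfun F).

Lemma mem_ip_orth u v : (v \in ip_orth u) = (ip v u == 0).
Proof. by rewrite memv_ker lfunE. Qed.

Section Operator.
Variable A : 'End(U).
Hypothesis A_sym : forall u v, ip (A u) v = ip u (A v).

(** The matrix of [A] on [W] has a complex eigenvalue [z], with an eigenvector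
    [x + i y].  Symmetry gives [Im z * (|x|^2 + |y|^2) = 0], so [z]
    is real, and [x] or [y] is a real eigenvector. *)
Lemma exists_eigenvector (W : {vspace U}) :
  (W != 0)%VS -> (forall u, u \in W -> A u \in W) ->
  exists u x, [/\ u \in W, u != 0 & A u = x *: u].
Proof.
move=> W0 AW; pose n := \dim W; pose e := vbasis W.
have eW (i : 'I_n) : e`_i \in W by apply/vbasis_mem/mem_nth; rewrite size_tuple.
pose M : 'M[R]_n := \matrix_(i, j) coord e j (A e`_i).
pose V (x : 'rV[R]_n) := \sum_i x 0 i *: e`_i.
have VW x : V x \in W by apply: rpred_sum => i _; apply: rpredZ.
have AV x : A (V x) = V (x *m M).
  rewrite linear_sum /=; transitivity (\sum_i \sum_j (x 0 i * M i j) *: e`_j).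
    apply: eq_bigr => i _; rewrite linearZ /= {1}(coord_vbasis (AW _ (eW i))).
    by rewrite scaler_sumr; apply: eq_bigr => j _; rewrite scalerA mxE.
  by rewrite exchange_big; apply: eq_bigr => j _; rewrite mxE scaler_suml.
have Vlin a x y : V (a *: x + y) = a *: V x + V y.
  rewrite /V scaler_sumr -big_split; apply: eq_bigr => i _.
  by rewrite !mxE scalerDl scalerA.
have V0 x : V x = 0 -> x = 0.
  move=> x0; apply/rowP => i; rewrite mxE.
  have /freeP := basis_free (vbasisP W) => /(_ (fun i => x 0 i)); apply.
  exact: x0.
have n0 : (0 < n)%N by rewrite lt0n dimv_eq0.
pose C := R[i]%C.
pose Mc : 'M[C]_n := map_mx (real_complex R) M.
have /closed_rootP[z] : size (char_poly Mc) != 1%N.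
  by rewrite size_char_poly; case: (n) n0.
rewrite -eigenvalue_root_char => /eigenvalueP[v vz v0].
pose x : 'rV[R]_n := \row_i complex.Re (v 0 i).
pose y : 'rV[R]_n := \row_i complex.Im (v 0 i).
have ReD (z1 z2 : C) : complex.Re (z1 + z2) = complex.Re z1 + complex.Re z2.
  by case: z1; case: z2.
have ImD (z1 z2 : C) : complex.Im (z1 + z2) = complex.Im z1 + complex.Im z2.
  by case: z1; case: z2.
have vM j : (v *m Mc) 0 j = \sum_i v 0 i * (real_complex R) (M i j).
  by rewrite mxE; apply: eq_bigr => i _; rewrite [Mc _ _]mxE.
have xM : x *m M = complex.Re z *: x + (- complex.Im z) *: y.
  apply/rowP => j; have := congr1 (fun u : 'rV_n => complex.Re (u 0 j)) vz.
  rewrite vM (big_morph _ ReD (erefl _)) !mxE => E.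
  rewrite [RHS](_ : _ = complex.Re (z * v 0 j)); last first.
    by case: (z) (v 0 j) => [a b] [c d] /=; rewrite mulNr.
  rewrite -E; apply: eq_bigr => i _; rewrite mxE.
  by case: (v 0 i) => c d /=; rewrite mulr0 subr0.
have yM : y *m M = complex.Im z *: x + complex.Re z *: y.
  apply/rowP => j; have := congr1 (fun u : 'rV_n => complex.Im (u 0 j)) vz.
  rewrite vM (big_morph _ ImD (erefl _)) !mxE => E.
  rewrite [RHS](_ : _ = complex.Im (z * v 0 j)); last first.
    by case: (z) (v 0 j) => [a b] [c d] /=; rewrite addrC.
  rewrite -E; apply: eq_bigr => i _; rewrite mxE.
  by case: (v 0 i) => c d /=; rewrite mulr0 add0r.
have VZ a t : V (a *: t) = a *: V t.
  have V00 : V 0 = 0 by rewrite /V big1 // => i _; rewrite mxE scale0r.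
  by have := Vlin a t 0; rewrite V00 !addr0.
have ax : A (V x) = complex.Re z *: V x + (- complex.Im z) *: V y.
  by rewrite AV xM Vlin VZ.
have ay : A (V y) = complex.Im z *: V x + complex.Re z *: V y.
  by rewrite AV yM Vlin VZ.
have nz : (V x != 0) || (V y != 0).
  rewrite -negb_and; apply: contra v0 => /andP[/eqP/V0 x0 /eqP/V0 y0].
  apply/eqP/rowP => i; rewrite mxE.
  have := congr1 (fun t : 'rV_n => t 0 i) x0;
    have := congr1 (fun t : 'rV_n => t 0 i) y0.
  by rewrite !mxE; case: (v 0 i) => a b /= -> ->.
have ip_ge0 u : 0 <= ip u u.
  by have [->|/ip_gt0/ltW //] := eqVneq u 0; rewrite ip0l.
(* compare <A x, y> with <x, A y> *)
have b0 : complex.Im z = 0.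
  have := A_sym (V x) (V y); rewrite ax ay ip_lin ipZl [RHS]ipC ip_lin ipZl.
  rewrite (ipC (V y) (V x)) => E.
  have : complex.Im z * (ip (V x) (V x) + ip (V y) (V y)) = 0.
    by move: E; set p := ip (V x) (V x); set q := ip (V y) (V y); set t := ip _ _; lra.
  move/eqP; rewrite mulf_eq0 => /orP[/eqP //|].
  rewrite paddr_eq0 // => /andP[/eqP x0 /eqP y0].
  by case/orP: nz => /ip_gt0; rewrite ?x0 ?y0 ltxx.
case/orP: nz => nz; [exists (V x)|exists (V y)]; exists (complex.Re z); split=> //.
  by rewrite ax b0 oppr0 scale0r addr0.
by rewrite ay b0 scale0r add0r.
Qed.

(** The orthogonal complement of an eigenvector is stable under a symmetric
    operator, which allows an induction on the dimension. *)
Lemma exists_eigenbasis (W : {vspace U}) :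
  (forall u, u \in W -> A u \in W) ->
  exists s : seq (U * R), [/\ {in s, forall e, e.1 \in W /\ A e.1 = e.2 *: e.1},
    {in s, forall e, ip e.1 e.1 = 1}, pairwise (fun e e' => ip e.1 e'.1 == 0) s
    & forall u, u \in W -> (forall e, e \in s -> ip u e.1 = 0) -> u = 0].
Proof.
have [m] := ubnP (\dim W); elim: m W => // m IH W; rewrite ltnS => dW AW.
have [->|W0] := eqVneq W 0%VS.
  by exists [::]; split=> // u; rewrite memv0 => /eqP.
have [u [x [uW u0 Au]]] := exists_eigenvector W0 AW.
pose W' := (W :&: ip_orth u)%VS.
have W'P v : (v \in W') = (v \in W) && (ip v u == 0) by rewrite memv_cap mem_ip_orth.
have uu := ip_gt0 u0.
have dW' : (\dim W' < m)%N.
  apply: leq_trans dW; rewrite ltn_neqAle (dimvS (capvSl _ _)) andbT.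
  apply/negP => /eqP d; have : u \in W'.
    suff -> : W' = W by [].
    by apply/eqP; rewrite eqEdim capvSl d leqnn.
  by rewrite W'P gt_eqF // andbF.
have AW' v : v \in W' -> A v \in W'.
  rewrite !W'P => /andP[vW /eqP vu]; rewrite AW // A_sym Au ipC ipZl ipC vu.
  by rewrite mulr0 eqxx.
have [s [s1 s2 s3 s4]] := IH _ dW' AW'.
pose k := (Num.sqrt (ip u u))^-1.
have k0 : k != 0 by rewrite invr_eq0 gt_eqF // sqrtr_gt0.
exists ((k *: u, x) :: s); split=> [e|e||v vW v0].
- rewrite inE => /predU1P[->|/s1[]]; last by rewrite W'P => /andP[].
  by rewrite /= rpredZ // linearZ /= Au !scalerA mulrC.
- rewrite inE => /predU1P[->|/s2 //].
  by rewrite /= ipZl ipC ipZl mulrA -expr2 /k exprVn sqr_sqrtr ?ltW // mulVf // gt_eqF.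
- rewrite /= s3 andbT; apply/allP => e /s1[+ _]; rewrite W'P => /andP[_ /eqP eu].
  by rewrite /= ipZl ipC eu mulr0.
apply: s4 => [|e es]; last by apply: v0; rewrite inE es orbT.
rewrite W'P vW /=; have := v0 (k *: u, x) (mem_head _ _).
by rewrite /= ipC ipZl ipC => /eqP; rewrite mulf_eq0 (negPf k0).
Qed.

Record eigenfamily := Eigenfamily {
  ef_size : nat;
  ef_vec : 'I_ef_size -> U;
  ef_val : 'I_ef_size -> R;
  ef_eigen : forall i, A (ef_vec i) = ef_val i *: ef_vec i;
  ef_orth : forall i j, ip (ef_vec i) (ef_vec j) = (i == j)%:R;
  ef_complete : forall u, (forall i, ip u (ef_vec i) = 0) -> u = 0 }.

Lemma exists_eigenfamily : exists _ : eigenfamily, True.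
Proof.
have [s [s1 s2 s3 s4]] := exists_eigenbasis (fun u _ => memvf (A u)).
pose e (i : 'I_(size s)) := nth (0, 0) s i.
have es i : e i \in s by apply: mem_nth.
unshelve eexists (@Eigenfamily (size s) (fun i => (e i).1) (fun i => (e i).2) _ _ _) => //.
- by move=> i; have [] := s1 _ (es i).
- move=> i j; have [<-|ij] := eqVneq i j; first exact: s2.
  have P (i1 i2 : 'I_(size s)) : (i1 < i2)%N -> ip (e i1).1 (e i2).1 = 0.
    move=> ii; have /(pairwiseP (0, 0))/(_ i1 i2) P := s3.
    by apply/eqP; apply: P; rewrite ?inE.
  case: (ltngtP i j) => [/P //|/P|/val_inj e1]; first by rewrite ipC.
  by rewrite e1 eqxx in ij.
move=> u u0; apply: s4 => [|p /(nthP (0, 0))[i si <-]]; first exact: memvf.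
exact: (u0 (Ordinal si)).
Qed.

Section Count.
Variables (J : finType) (w : J -> U) (lam : J -> R).
Hypothesis w_eigen : forall j, A (w j) = lam j *: w j.
Hypothesis w_orth : forall i j, ip (w i) (w j) = (i == j)%:R.
Hypothesis w_complete : forall u, (forall j, ip u (w j) = 0) -> u = 0.

Lemma orth_expand u : u = \sum_j ip u (w j) *: w j.
Proof.
apply/eqP; rewrite -subr_eq0; apply/eqP/w_complete => j.
rewrite -scaleN1r addrC ip_lin ip_suml (bigD1 j) //= big1 => [|i ij].
  by rewrite ipZl w_orth eqxx mulr1 addr0 mulN1r addNr.
by rewrite ipZl w_orth (negPf ij) mulr0.
Qed.

Lemma mem_leigenspace x u :
  (u \in passmx.leigenspace A x) = (A u == x *: u).
Proof.
by rewrite memv_ker add_lfunE opp_lfunE scale_lfunE id_lfunE subr_eq0.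
Qed.

Lemma free_orth (s : seq J) : uniq s -> free [seq w j | j <- s].
Proof.
elim: s => [|j s IH] /=; first by rewrite nil_free.
move=> /andP[js us]; rewrite free_cons IH // andbT; apply/negP => wj.
have : ip (w j) (w j) = 0; last by rewrite w_orth eqxx => /eqP; rewrite oner_eq0.
rewrite {1}(coord_span (X := in_tuple _) wj) ip_suml big1 // => i _.
have /mapP[k ks ->] := mem_nth 0 (ltn_ord i).
rewrite ipZl w_orth; case: eqP => [kj|_]; last by rewrite mulr0.
by rewrite -kj ks in js.
Qed.

Lemma spec_card x : spec A x = #|[pred j | lam j == x]|.
Proof.
have -> : #|[pred j | lam j == x]| =
    size [seq w j | j <- enum [pred j | lam j == x]].
  by rewrite size_map cardE.
have /eqP <- := free_orth (enum_uniq [pred j | lam j == x]).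
rewrite /spec; congr (\dim _); apply/vspaceP => u; apply/idP/idP; last first.
  move=> us; rewrite mem_leigenspace (coord_span (X := in_tuple _) us).
  rewrite linear_sum /= scaler_sumr; apply/eqP/eq_bigr => i _.
  have /mapP[k] := mem_nth 0 (ltn_ord i).
  rewrite mem_enum inE => /eqP kx ->.
  by rewrite linearZ /= w_eigen kx !scalerA mulrC.
rewrite mem_leigenspace => /eqP Au; rewrite [u]orth_expand.
apply: rpred_sum => j _; have [jx|jx] := eqVneq (lam j) x.
  by apply/rpredZ/memv_span/map_f; rewrite mem_enum inE jx.
suff -> : ip u (w j) = 0 by rewrite scale0r mem0v.
have := A_sym u (w j); rewrite Au w_eigen ipZl [RHS]ipC ipZl [ip (w j) u]ipC => /eqP.
rewrite -subr_eq0 -mulrBl mulf_eq0 subr_eq0 eq_sym (negPf jx) => /eqP; exact.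
Qed.

Lemma card_orth : #|J| = \dim {:U}.
Proof.
rewrite cardE -(size_map w) -(eqP (free_orth (enum_uniq J))).
congr (\dim _); apply/vspaceP => u; rewrite memvf; rewrite [u]orth_expand.
by apply: rpred_sum => j _; apply/rpredZ/memv_span/map_f; rewrite mem_enum.
Qed.
End Count.
End Operator.
End Spectral.
Arguments ef_vec {R U ip A} e i.
Arguments ef_val {R U ip A} e i.
Arguments ef_eigen {R U ip A} e i.
Arguments ef_orth {R U ip A} e i j.
Arguments ef_complete {R U ip A} e u.

(** * The spectrum of a product *)

Lemma perm_of_counts (R : eqType) m n (f : 'I_m -> R) (g : 'I_n -> R) :
  (forall x, #|[pred i | f i == x]| = #|[pred i | g i == x]|) ->
  perm_eq [seq f i | i <- enum 'I_m] [seq g i | i <- enum 'I_n].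
Proof.
have C k (h : 'I_k -> R) x : count_mem x [seq h i | i <- enum 'I_k] =
    #|[pred i | h i == x]|.
  by rewrite count_map cardE -size_filter enumT.
by move=> fg; apply/allP => x _ /=; rewrite !C fg.
Qed.

Section HodgeFamily.
Variables (R : realType) (G : digraph) (a : nat -> R).
Hypothesis a_gt0 : forall p, 0 < a p.

Lemma inner_gt0 p (u : subvs_of (Omega R G p)) : u != 0 -> 0 < inner a u u.
Proof.
move=> u0; rewrite lt_def; apply/andP; split.
  by apply: contra u0 => /eqP/(inner_eq0 a_gt0)/eqP.
rewrite /inner mulr_ge0 ?invr_ge0 ?(ltW (a_gt0 p)) // sumr_ge0 // => t _.
by rewrite -expr2 sqr_ge0.
Qed.

Lemma laplacianE p (u : subvs_of (Omega R G p)) : hodge_laplacian R G a p u =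
  dOmega R G p.+1 (codOmega G a p.+1 u) + codOmega G a p (dOmega R G p u).
Proof. by rewrite /hodge_laplacian add_lfunE !comp_lfunE. Qed.

Lemma laplacian_sym p (u v : subvs_of (Omega R G p)) :
  inner a (hodge_laplacian R G a p u) v = inner a u (hodge_laplacian R G a p v).
Proof.
have E1 u1 v1 : inner a (dOmega R G p.+1 (codOmega G a p.+1 u1) : subvs_of (Omega R G p)) v1 =
    inner a (codOmega G a p.+1 u1) (codOmega G a p.+1 v1).
  exact: (@codOmegaE R G a a_gt0 p.+1 (codOmega G a p.+1 u1) v1).
have E2 u1 v1 : inner a (codOmega G a p (dOmega R G p u1)) v1 =
    inner a (dOmega R G p u1) (dOmega R G p v1).
  by rewrite innerC -(codOmegaE a_gt0) innerC.
rewrite !laplacianE innerDl innerDr.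
rewrite [X in _ = X + _]innerC [X in _ = _ + X]innerC !E1 !E2.
by congr (_ + _); rewrite innerC.
Qed.

Definition laplacian_family p := projT1 (cid (exists_eigenfamily (ip := @inner R G a p)
  (@innerP R G a p) (@innerC R G a p) (@inner_gt0 p) (@laplacian_sym p))).

Lemma spec_laplacian_family p x : spec (hodge_laplacian R G a p) x =
  #|[pred i | ef_val (laplacian_family p) i == x]|.
Proof.
apply: (spec_card (@innerP R G a p) (@innerC R G a p) (@laplacian_sym p)
  (ef_eigen (laplacian_family p)) (ef_orth (laplacian_family p)) (ef_complete (laplacian_family p))).
Qed.

Lemma size_laplacian_family p : ef_size (laplacian_family p) = \dim (Omega R G p).
Proof.
have := card_orth (@innerP R G a p) 
  (ef_orth (laplacian_family p)) (ef_complete (laplacian_family p)).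
by rewrite card_ord dimvf.
Qed.
End HodgeFamily.

Section SpecCross.
Variables (R : realType) (X Y : digraph).
Let a (q : nat) : R := q`!%:R.
Let a_gt0 := @fact_gt0R R.
Let eX p := laplacian_family X a_gt0 p.
Let eY p := laplacian_family Y a_gt0 p.

Lemma crossO_expand r p q (u : subvs_of (Omega R X p)) (v : subvs_of (Omega R Y q)) :
  crossO r u v = \sum_i \sum_j (inner a u (ef_vec (eX p) i) * inner a v (ef_vec (eY q) j))
     *: crossO r (ef_vec (eX p) i) (ef_vec (eY q) j).
Proof.
rewrite {1}(orth_expand (@innerP R X a p) (ef_orth (eX p))
   (ef_complete (eX p)) u).
rewrite (big_morph (fun u => crossO r u v) (id1 := 0) (op1 := +%R)); last 2 first.
- by move=> x y; apply: crossODl.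
- exact: crossO0l.
apply: eq_bigr => i _; rewrite crossOZl.
rewrite {1}(orth_expand (@innerP R Y a q) (ef_orth (eY q))
   (ef_complete (eY q)) v).
rewrite (big_morph (fun v => crossO r _ v) (id1 := 0) (op1 := +%R)); last 2 first.
- by move=> x y; apply: crossODr.
- exact: crossO0r.
by rewrite scaler_sumr; apply: eq_bigr => j _; rewrite crossOZr scalerA.
Qed.

(** Cross products of different bidegrees are orthogonal, so those of the
    orthonormal eigenvectors of [X] and [Y] form an orthonormal eigenbasis; the
    multiplicities are then counted pair by pair. *)
Lemma spec_cross r x : spec (hodge_laplacian R (cart X Y) a r) x =
  (\sum_(p < r.+1) \sum_i
     spec (hodge_laplacian R Y a (r - p)) (x - ef_val (eX p) i))%N.
Proof.
pose T (p : 'I_r.+1) : finType := ('I_(ef_size (eX p)) * 'I_(ef_size (eY (r - p))))%type.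
pose J : finType := {p : 'I_r.+1 & T p}.
pose w (k : J) := crossO r (ef_vec (eX (tag k)) (tagged k).1)
                           (ef_vec (eY (r - tag k)) (tagged k).2).
pose lam (k : J) := ef_val (eX (tag k)) (tagged k).1 +
                    ef_val (eY (r - tag k)) (tagged k).2.
have kr (p : 'I_r.+1) : (p + (r - p))%N = r by rewrite subnKC // -ltnS.
have w_eigen k : hodge_laplacian R (cart X Y) a r (w k) = lam k *: w k.
  rewrite /w laplacian_cross // (ef_eigen (eX _)) (ef_eigen (eY _)).
  by rewrite crossOZl crossOZr -scalerDl.
have w_orth k l : inner a (w k) (w l) = (k == l)%:R.
  case: k l => [p [i j]] [p' [i' j']];
    rewrite /w /= (inner_cross _ _ _ _ (kr p) (kr p')).
  have [pp|pp] := eqVneq p p'; last first.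
    rewrite pairing_out ?mul0r; last by apply: contra pp => /eqP/val_inj ->.
    by rewrite -tag_eqE /tag_eq /= (negPf pp).
  case: p' / pp i' j' => i' j'; rewrite -!pairing_inner !ef_orth -natrM mulnb.
  by rewrite eq_Tagged xpair_eqE.
have w_complete u : (forall k, inner a u (w k) = 0) -> u = 0.
  move=> u0; apply: oev_inj => z; rewrite oev0; move: z.
  apply: (omega_cross_orth (oev_omega u)) => p q f g pq fO gO.
  have pr : (p < r.+1)%N by rewrite ltnS -pq leq_addr.
  have qE : (r - Ordinal pr)%N = q by rewrite /= -pq addKn.
  case: q / qE pq gO => pq gO.
  pose u' := omega_of p f; pose v' := omega_of (r - Ordinal pr) g.
  suff: inner a u (crossO r u' v') = 0.
    rewrite inner_seq_sum => /eqP;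
      rewrite mulf_eq0 invr_eq0 gt_eqF ?(a_gt0 r) //= => /eqP <-.
    apply: eq_seq_sum => z _; rewrite oev_crossO //; congr (_ * _).
    by congr cross; apply/funext => s; apply/funext => t; rewrite /tensor !oev_omega_of.
  rewrite crossO_expand innerC (ip_suml (@innerP R _ a r)) big1 // => i _.
  rewrite (ip_suml (@innerP R _ a r)) big1 // => j _.
  rewrite innerZl [inner a (crossO _ _ _) _]innerC.
  by have := u0 (@Tagged _ (Ordinal pr) T (i, j)); rewrite /w /= => ->; rewrite mulr0.
rewrite (spec_card (@innerP R _ a r) (@innerC R _ a r) (@laplacian_sym R _ a a_gt0 r)
   w_eigen w_orth w_complete) -sum1_card.
transitivity (\sum_(p < r.+1) \sum_(ij : T p |
   (ef_val (eX p) ij.1 + ef_val (eY (r - p)) ij.2)%R == x) 1)%N.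
  rewrite (sig_big_dep xpredT (fun p (ij : T p) =>
    ef_val (eX p) ij.1 + ef_val (eY (r - p)) ij.2 == x) (fun p _ => 1%N)).
  by apply: eq_bigl => -[p ij]; rewrite inE.
apply: eq_bigr => p _.
transitivity (\sum_i \sum_(j | (ef_val (eX p) i + ef_val (eY (r - p)) j)%R == x) 1)%N.
  by rewrite pair_big_dep.
apply: eq_bigr => i _; rewrite sum1_card (spec_laplacian_family Y a_gt0).
by apply: eq_card => j; rewrite !inE [RHS]eq_sym subr_eq addrC eq_sym.
Qed.
End SpecCross.

(** * Change of weights *)

Section EigenAlgebra.
Variables (R : realType).

(** [g] maps the eigenspace of [f \o g] injectively into that of [g \o f]. *)
Lemma spec_swap (U V : vectType R) (f : 'Hom(U, V)) (g : 'Hom(V, U)) x :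
  x != 0 -> spec (f \o g)%VF x = spec (g \o f)%VF x.
Proof.
move=> x0.
have half (U1 V1 : vectType R) (f1 : 'Hom(U1, V1)) (g1 : 'Hom(V1, U1)) :
    (spec (f1 \o g1)%VF x <= spec (g1 \o f1)%VF x)%N.
  rewrite /spec -(limg_dim_eq (f := g1)); last first.
    apply/eqP; rewrite -subv0; apply/subvP => u.
    rewrite memv_cap mem_leigenspace memv_ker comp_lfunE => /andP[/eqP E /eqP gu].
    move: E; rewrite gu linear0 => /esym/eqP.
    by rewrite scaler_eq0 (negPf x0) memv0.
  apply: dimvS; apply/subvP => _ /memv_imgP[u + ->].
  rewrite !mem_leigenspace !comp_lfunE => /eqP ->.
  by rewrite linearZ.
by apply/eqP; rewrite eqn_leq !half.
Qed.

(** For [x != 0] the image of [L] contains the eigenspace of [L] and is killed by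
    [K], and conversely; so the eigenspace of the sum is the direct sum of the
    two eigenspaces. *)
Lemma spec_add (U : vectType R) (L K : 'End(U)) x :
  (forall u, L (K u) = 0) -> (forall u, K (L u) = 0) -> x != 0 ->
  spec (L + K)%VF x = (spec L x + spec K x)%N.
Proof.
move=> LK KL x0; have ux (u : U) : u = x^-1 *: (x *: u).
  by rewrite scalerA mulVf // scale1r.
rewrite /spec -dimv_disjoint_sum; last first.
  apply/eqP; rewrite -subv0; apply/subvP => u.
  rewrite memv_cap !mem_leigenspace memv0 => /andP[/eqP Lu /eqP Ku].
  by rewrite [u]ux -Lu [u]ux -Ku !linearZ /= LK !scaler0.
congr (\dim _); apply/eqP; rewrite eqEsubv; apply/andP; split; apply/subvP => u.
  rewrite mem_leigenspace add_lfunE => /eqP Eu.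
  rewrite [u]ux -Eu scalerDr memv_add // mem_leigenspace linearZ /= scalerA.
    have := congr1 L Eu; rewrite linearD /= LK addr0 linearZ /= => ->.
    by rewrite scalerA mulrC.
  have := congr1 K Eu; rewrite linearD /= KL add0r linearZ /= => ->.
  by rewrite scalerA mulrC.
case/memv_addP => v + [w + ->]; rewrite !mem_leigenspace => /eqP Lv /eqP Kw.
rewrite add_lfunE !linearD /= Lv Kw.
have -> : K v = 0 by rewrite [v]ux -Lv linearZ /= KL scaler0.
have -> : L w = 0 by rewrite [w]ux -Kw linearZ /= LK scaler0.
by rewrite addr0 add0r ?scalerDr.
Qed.

Lemma spec_scale (U : vectType R) (K : 'End(U)) c x : c != 0 ->
  spec (c *: K)%VF x = spec K (x / c).
Proof.
move=> c0; rewrite /spec; congr (\dim _); apply/vspaceP => u.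
rewrite !mem_leigenspace scale_lfunE -(inj_eq (scalerI c0) (K u)) scalerA.
by rewrite mulrCA divff // mulr1.
Qed.

Lemma spec_le_dim (U : vectType R) (K : 'End(U)) x : (spec K x <= \dim {:U})%N.
Proof. by apply: dimvS; apply: subvf. Qed.
End EigenAlgebra.

Section Weights.
Variables (R : realType) (G : digraph).

Definition down_laplacian (a : nat -> R) p : 'End(subvs_of (Omega R G p)) :=
  (codOmega G a p \o dOmega R G p)%VF.
Definition up_laplacian (a : nat -> R) p : 'End(subvs_of (Omega R G p)) :=
  (dOmega R G p.+1 \o codOmega G a p.+1)%VF.

Let one_gt0 (p : nat) : 0 < (fun=> 1 : R) p.
Proof. exact: ltr01. Qed.

Lemma codOmega_weight (a : nat -> R) p (v : subvs_of (Omega R G p.-1)) :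
  (forall p, 0 < a p) ->
  codOmega G a p v = (a p / a p.-1) *: codOmega G (fun=> 1%R) p v.
Proof.
move=> a_gt0; apply/eqP; rewrite -subr_eq0; apply/eqP.
apply: (inner_nondeg a_gt0) => u.
have inner1 q (x y : subvs_of (Omega R G q)) : inner a x y = (a q)^-1 * inner (fun=> 1%R) x y.
  by rewrite /inner invr1 mul1r.
have C0 q : a q != 0 by rewrite gt_eqF.
rewrite innerC -scaleN1r innerDr !innerZr -(codOmegaE a_gt0) inner1 [inner a u _]inner1.
rewrite -(codOmegaE one_gt0).
by field; rewrite !C0.
Qed.

(** The first term is the contribution of the boundary after the coboundary,
    moved up by one degree by [spec_swap]. *)
Lemma spec_laplacian (a : nat -> R) p x : (forall p, 0 < a p) -> x != 0 ->
  spec (hodge_laplacian R G a p) x =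
  (spec (down_laplacian (fun=> 1%R) p.+1) (x / (a p.+1 / a p)) +
   spec (down_laplacian (fun=> 1%R) p) (x / (a p / a p.-1)))%N.
Proof.
move=> a_gt0 x0.
have C0 q : a q / a q.-1 != 0 by rewrite mulf_neq0 ?invr_eq0 // gt_eqF.
have dE q : down_laplacian a q = ((a q / a q.-1) *: down_laplacian (fun=> 1%R) q)%VF.
  by apply/lfunP => u; rewrite scale_lfunE !comp_lfunE codOmega_weight.
rewrite [hodge_laplacian _ _ _ _]/(up_laplacian a p + down_laplacian a p)%VF spec_add //.
- congr (_ + _)%N; last by rewrite dE spec_scale.
  transitivity (spec (down_laplacian a p.+1) x); first exact: spec_swap.
  by rewrite dE spec_scale.
- move=> u; rewrite !comp_lfunE (codOmega_codOmega a_gt0); exact: linear0.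
move=> u; rewrite !comp_lfunE.
by rewrite (dOmega_dOmega (p := p.+1)) linear0.
Qed.

Lemma down_laplacian0 y : y != 0 -> spec (down_laplacian (fun=> 1%R) 0) y = 0%N.
Proof.
move=> y0; rewrite /spec; apply/eqP; rewrite dimv_eq0 -subv0; apply/subvP => u.
rewrite mem_leigenspace comp_lfunE dOmega0 linear0 eq_sym scaler_eq0 (negPf y0).
by rewrite memv0.
Qed.
End Weights.

(** * Spectral data independent of the weights *)

Section Data.
Variables (R : realType) (G G' : digraph).

Definition same_down p := forall y : R, y != 0 ->
  spec (down_laplacian G (fun=> 1 : R) p) y = spec (down_laplacian G' (fun=> 1 : R) p) y.
Definition same_dim p := \dim (Omega R G p) = \dim (Omega R G' p).

Variable a : nat -> R.
Hypothesis a_gt0 : forall p, 0 < a p.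
Let same_spec p :=
  spec (hodge_laplacian R G a p) =1 spec (hodge_laplacian R G' a p).

Lemma same_spec_perm p : same_spec p ->
  perm_eq [seq ef_val (laplacian_family G a_gt0 p) i | i <- enum 'I__]
          [seq ef_val (laplacian_family G' a_gt0 p) i | i <- enum 'I__].
Proof.
by move=> s; apply: perm_of_counts => x; rewrite -!spec_laplacian_family s.
Qed.

Lemma same_spec_dim p : same_spec p -> same_dim p.
Proof.
have H k (f : 'I_k -> R) : size [seq f i | i <- enum 'I_k] = k.
  by rewrite size_map size_enum_ord.
move/same_spec_perm/perm_size; rewrite !H.
by rewrite !size_laplacian_family.
Qed.

(** The nonzero part of the spectrum in degree [p] is the union of those of the
    lower Laplacians in degrees [p] and [p.+1], rescaled; knowing the one in degree [p]
    leaves that in degree [p.+1]. *)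
Lemma same_spec_down P : (forall p, (p <= P)%N -> same_spec p) ->
  forall p, (p <= P.+1)%N -> same_down p.
Proof.
move=> S; elim=> [_ y y0|p IH pP y y0]; first by rewrite !down_laplacian0.
have C0 q : a q / a q.-1 != 0 by rewrite mulf_neq0 ?invr_eq0 // gt_eqF.
pose x := y * (a p.+1 / a p).
have x0 : x != 0 by rewrite mulf_neq0 // (C0 p.+1).
have := S p pP x; rewrite !spec_laplacian //.
rewrite (IH (ltnW pP)); last by rewrite mulf_neq0 // invr_eq0.
by rewrite /x mulfK ?(C0 p.+1) // => /addIn.
Qed.

(** The nonzero eigenvalues come from [spec_laplacian]; the multiplicity of zero
    is the dimension minus the number of nonzero eigenvalues. *)
Lemma same_data_spec p :
  (forall q, same_dim q) -> (forall q, same_down q) -> same_spec p.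
Proof.
move=> D S.
have C0 q : a q / a q.-1 != 0 by rewrite mulf_neq0 ?invr_eq0 // gt_eqF.
have nz x : x != 0 ->
    spec (hodge_laplacian R G a p) x = spec (hodge_laplacian R G' a p) x.
  move=> x0; rewrite !spec_laplacian //.
  by rewrite !S // mulf_neq0 // invr_eq0 ?(C0 p) ?(C0 p.+1).
move=> x; have [->|] := eqVneq x 0; last exact: nz.
have C (H : digraph) : spec (hodge_laplacian R H a p) 0 =
    (\dim (Omega R H p) -
     size [seq y <- [seq ef_val (laplacian_family H a_gt0 p) i | i <- enum 'I__] | y != 0%R])%N.
  rewrite -(size_laplacian_family H a_gt0) spec_laplacian_family size_filter.
  set s := map _ _.
  transitivity (size s - count (fun y => y != 0%R) s)%N; last first.
    by rewrite {1}/s size_map size_enum_ord.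
  rewrite -(count_predC (fun y => y != 0) s) addKn /s count_map cardE -size_filter.
  by rewrite enumT; congr size; apply: eq_filter => i /=; rewrite negbK.
rewrite !C D; congr (_ - _)%N; apply: perm_size.
apply/allP => y _ /=; rewrite !count_filter.
have [->|y0] := eqVneq y 0.
  rewrite !(eq_count (a2 := pred0)) ?count_pred0 // => z /=;
  by case: eqP.
have E (s : seq R) : count (predI (pred1 y) (fun z => z != 0)) s = count_mem y s.
  by apply: eq_count => z /=; case: eqP => // ->.
rewrite !E.
have C2 (H : digraph) :
    count_mem y [seq ef_val (laplacian_family H a_gt0 p) i | i <- enum 'I__] =
    spec (hodge_laplacian R H a p) y.
  by rewrite count_map (spec_laplacian_family H a_gt0) cardE -size_filter enumT.
by rewrite !C2 nz.
Qed.
End Data.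

(** * The three determinations *)

Section Powers.
Variables (R : realType).
Let a (q : nat) : R := q`!%:R.

Lemma normalized_spec_cross (X X' Y Y' : digraph) :
  normalized_hodge_spec R X =2 normalized_hodge_spec R X' ->
  normalized_hodge_spec R Y =2 normalized_hodge_spec R Y' ->
  normalized_hodge_spec R (cart X Y) =2 normalized_hodge_spec R (cart X' Y').
Proof.
move=> XX YY r x; rewrite /normalized_hodge_spec !spec_cross.
apply: eq_bigr => p _.
have := same_spec_perm (fact_gt0R R) (XX p).
set s := map _ _; set s' := map _ _ => ss.
transitivity (\sum_(y <- s) spec (hodge_laplacian R Y a (r - p)) (x - y))%N.
  by rewrite big_map big_enum.
rewrite (perm_big _ ss) big_map big_enum; apply: eq_bigr => i _.
exact: YY.
Qed.

Lemma normalized_spec_pow (X X' : digraph) n : (1 <= n)%N ->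
  normalized_hodge_spec R X =2 normalized_hodge_spec R X' ->
  normalized_hodge_spec R (cart_pow X n) =2 normalized_hodge_spec R (cart_pow X' n).
Proof.
move=> + XX; case: n => // n _; elim: n => [|n IH]; first exact: XX.
exact: normalized_spec_cross.
Qed.

Lemma spec_transfer (b c : nat -> R) (X X' : digraph) :
  (forall p, 0 < b p) -> (forall p, 0 < c p) ->
  (forall p, spec (hodge_laplacian R X b p) =1 spec (hodge_laplacian R X' b p)) ->
  forall p, spec (hodge_laplacian R X c p) =1 spec (hodge_laplacian R X' c p).
Proof.
move=> b0 c0 S p; apply: same_data_spec => // q.
  exact: (same_spec_dim b0).
by apply: (same_spec_down b0 (P := q)).
Qed.

(** The slices of an element of [Omega] at its first vertex are in [Omega] one
    degree below, so they vanish if that space does. *)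
Lemma Omega_stable (G : digraph) r p : Omega R G r = 0%VS -> (r <= p)%N ->
  Omega R G p = 0%VS.
Proof.
move=> O0 /subnK <-; elim: (p - r)%N => [//|k IH]; rewrite addSn.
apply/eqP; rewrite -subv0; apply/subvP => u /OmegaP uO; rewrite memv0; apply/eqP.
apply: ev_inj => s; rewrite (omega_vanish _ uO).
  by rewrite /ev big1 // => t _; rewrite ffunE.
move=> f fO; have := subvsP (omega_of (k + r) f); rewrite {2}IH memv0 => /eqP f0.
apply/funext => t; rewrite -(oev_omega_of fO) /oev f0.
by rewrite /ev big1 // => t' _; rewrite ffunE.
Qed.

Lemma euler_charE (G : digraph) r : Omega R G r = 0%VS ->
  euler_char R G = \sum_(p < r) (-1) ^+ p * (\dim (Omega R G p))%:Z.
Proof.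
move=> O0;
  rewrite /euler_char (fsbig_ord _ r (fun p => (-1) ^+ p * (\dim (Omega R G p))%:Z)).
apply/esym/fsbig_widen => // p [_ /= /negP]; rewrite -leqNgt => rp.
by rewrite (Omega_stable O0 rp) dimv0 mulr0.
Qed.
End Powers.

Theorem theorem7p9 (R : realType) (n : nat) (n_gt0 : (1 <= n)%N) :
  [/\ (forall G G' : digraph,
         normalized_hodge_spec R G =2 normalized_hodge_spec R G' ->
         hodge_spec R (cart_pow G n) =2 hodge_spec R (cart_pow G' n)),
      (forall G G' : digraph,
         hodge_spec R G =2 hodge_spec R G' ->
         hodge_spec R (cart_pow G n) =2 hodge_spec R (cart_pow G' n))
    & (forall (r : nat) (G G' : digraph), (2 <= r)%N ->
         Omega R G r = 0%VS -> Omega R G' r = 0%VS ->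
         euler_char R G = euler_char R G' ->
         (forall q : nat, (q <= r - 2)%N ->
            hodge_spec R G q =1 hodge_spec R G' q) ->
         hodge_spec R (cart_pow G n) =2 hodge_spec R (cart_pow G' n))].
Proof.
have one0 (p : nat) : 0 < (fun=> 1 : R) p by exact: ltr01.
have A (G G' : digraph) : normalized_hodge_spec R G =2 normalized_hodge_spec R G' ->
    hodge_spec R (cart_pow G n) =2 hodge_spec R (cart_pow G' n).
  move=> S; apply: (spec_transfer (fact_gt0R R) one0); exact: normalized_spec_pow.
have B (G G' : digraph) : hodge_spec R G =2 hodge_spec R G' ->
    hodge_spec R (cart_pow G n) =2 hodge_spec R (cart_pow G' n).
  by move=> S; apply: A; apply: (spec_transfer one0 (fact_gt0R R)).
split=> // r G G' r2 O0 O0' E S; apply: B => p.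
have dims q : same_dim R G G' q.
  have [qr|rq] := leqP r q;
    first by rewrite /same_dim (Omega_stable O0 qr) (Omega_stable O0' qr) !dimv0.
  case: (leqP q (r - 2)) => [q2|q2]; first exact: (same_spec_dim one0 (S q q2)).
  (* q = r - 1: all other terms of the two Euler characteristics agree *)
  have qE : r = q.+1 by lia.
  move: E; rewrite (euler_charE O0) (euler_charE O0') qE !big_ord_recr /=.
  under eq_bigr => i _.
    rewrite (same_spec_dim one0 (S i _)); last by have := ltn_ord i; lia.
    over.
  move/addrI => /eqP; rewrite -subr_eq0 -mulrBr mulf_eq0 signr_eq0 subr_eq0 /=.
  by move/eqP => [].
apply: (same_data_spec one0) => // q.
have [qr|rq] := leqP r q.
  move=> y _;
    have H (H : digraph) : Omega R H r = 0%VS -> spec (down_laplacian H (fun=> 1 : R) q) y = 0%N.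
    move=> OH; apply/eqP; rewrite -leqn0 (leq_trans (spec_le_dim _ _)) //.
    by rewrite dimvf /dim /= (Omega_stable OH qr) dimv0.
  by rewrite !H.
by apply: (same_spec_down one0 (P := (r - 2)%N)) => //; lia.
Qed.
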